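(* Let $\prec$ be a (strict) partial order of length $\lambda_\prec$ on the set $[n]=\{1,\dots,n\}$, and let $q=p^f$ with $f\ge1$, where $p$ is a prime with $p>\lambda_\prec$. Then $$m_{\mathrm{faithful}}\big(\exp(\mathfrak{g}_\prec\otimes_{\mathbb{Z}}\mathbb{F}_q)\big)=\sum_{(i,j)\in I_{\mathrm{ex}}} f\,q^{\alpha(i,j)}.$$
   Context: For a finite group $G$, $m_{\mathrm{faithful}}(G)$ denotes the smallest dimension of a faithful complex representation of $G$. For a finite $\mathbb{Z}$-Lie algebra $L$ of $p$-power order, nilpotent of class less than $p$, $\exp(L)$ is the group with underlying set $L$ and multiplication given by the Baker–Campbell–Hausdorff formula $x*y=x+y+\frac12[x,y]+\cdots$ (Lazard correspondence). The pattern Lie algebra is $\mathfrak{g}_\prec:=\mathrm{Span}_{\mathbb{Z}}\{\mathbf e_{ij}: i\prec j\}\subseteq\mathfrak{gl}(n,\mathbb{Z})$ with the commutator bracket, where $\mathbf e_{ij}$ is the $n\times n$ matrix whose unique nonzero entry is a $1$ in position $(i,j)$; it is nilpotent of class $\lambda_\prec$. The length $\lambda_\prec$ is the maximum $r$ such that there is a chain $i_0\prec i_1\prec\cdots\prec i_r$ in $[n]$. For $i\prec j$, $\alpha(i,j):=\#\{k\in[n]: i\prec k\prec j\}$. $I_{\mathrm{ex}}$ is the set of extreme pairs: ordered pairs $(i,j)$ with $i$ a minimal element and $j$ a maximal element of $([n],\prec)$ and $i\prec j$. *)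

(* Defs.v *)
From HB Require Import structures.
From mathcomp Require Import all_boot all_order all_algebra all_fingroup.
From mathcomp Require Import mxrepresentation.
From mathcomp Require Import ring.
From mathcomp Require Export reals complex.

Set Implicit Arguments.
Unset Strict Implicit.
Unset Printing Implicit Defensive.

Import GRing.Theory.
Local Open Scope ring_scope.

HB.mixin Record isLieRing L of GRing.Zmodule L := {
  lieb : L -> L -> L;
  liebDl : forall x y z, lieb (x + y) z = lieb x z + lieb y z;
  liebDr : forall x y z, lieb x (y + z) = lieb x y + lieb x z;
  liebxx : forall x, lieb x x = 0;
  lieb_jacobi : forall x y z,
    lieb x (lieb y z) + lieb y (lieb z x) + lieb z (lieb x y) = 0
}.

#[short(type="lieRingType")]
HB.structure Definition LieRing := {L of isLieRing L & GRing.Zmodule L}.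

#[short(type="finLieRingType")]
HB.structure Definition FinLieRing := {L of LieRing L & Finite L}.

Section BCH.

Variable L : finLieRingType.

Lemma mulrn_card (x : L) : x *+ #|L| = 0.
Proof.
apply: (addIr (\sum_y y)); rewrite add0r -sumr_const -big_split /=.
by rewrite [RHS](reindex_inj (addrI x)).
Qed.

(* The action of a rational c on L, meaningful when the denominator d of c is
   prime to #|L|: multiplication by d is then invertible on L, and its inverse
   is multiplication by any u with u * d = 1 mod #|L| (see rat_scaleP). *)
Definition rat_scale (c : rat) (x : L) : L :=
  (x *+ (egcdn `|denq c|%N #|L|).1) *~ numq c.

Lemma rat_scaleP (c : rat) (x : L) :
  coprime `|denq c|%N #|L| -> rat_scale c x *~ denq c = x *~ numq c.
Proof.
move=> co; rewrite /rat_scale; case: egcdnP; first by rewrite absz_gt0 denq_neq0.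
move=> u v uv _ /=; rewrite (eqP co) in uv.
have -> : denq c = `|denq c|%N by rewrite gtz0_abs ?denq_gt0.
rewrite mulrzAC -pmulrn -mulrnA uv mulrnDr mulnC mulrnA.
by rewrite mulrn_card mul0rn add0r.
Qed.

(* [a_1, [a_2, ... [a_(m-1), a_m] ...]] *)
Fixpoint lie_word (w : seq L) : L :=
  match w with
  | [::] => 0
  | [:: a] => a
  | a :: w' => lieb a (lie_word w')
  end.

(* [:: (r_1, s_1); ...; (r_k, s_k)] encodes the word x^r_1 y^s_1 ... x^r_k y^s_k *)
Definition dynkin_word (x y : L) (rs : seq (nat * nat)) : seq L :=
  flatten [seq nseq t.1 x ++ nseq t.2 y | t <- rs].

Definition dynkin_degree (rs : seq (nat * nat)) : nat :=
  (\sum_(t <- rs) (t.1 + t.2))%N.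

Definition dynkin_coef (rs : seq (nat * nat)) : rat :=
  (-1) ^+ (size rs).-1 /
  ((size rs)%:R * (dynkin_degree rs)%:R
     * \prod_(t <- rs) ((t.1)`! * (t.2)`!)%N%:R).

Definition nat_pairs (p k : nat) (rs : k.-tuple ('I_p * 'I_p)) :
    seq (nat * nat) :=
  [seq (val t.1, val t.2) | t <- rs].

Definition dynkin_index (p : nat) (rs : seq (nat * nat)) : bool :=
  all (fun t => 0 < t.1 + t.2)%N rs && (dynkin_degree rs < p)%N.

(* The terms of degree < p of the Baker-Campbell-Hausdorff series in Dynkin's
   form, i.e. the sum of
     (-1)^(k-1)/k * [x^r_1 y^s_1 ... x^r_k y^s_k]
       / ((r_1 + s_1 + ... + r_k + s_k) * r_1! s_1! ... r_k! s_k!)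
   over k >= 1 and pairs (r_i, s_i) <> (0, 0). In these terms k, r_i and s_i
   are all < p. When L has p-power order and class less than p, the omitted
   brackets vanish and the remaining denominators are prime to #|L|. *)
Definition bch (p : nat) (x y : L) : L :=
  \sum_(1 <= k < p)
    \sum_(rs : k.-tuple ('I_p * 'I_p) | dynkin_index p (nat_pairs rs))
      rat_scale (dynkin_coef (nat_pairs rs))
                (lie_word (dynkin_word x y (nat_pairs rs))).

End BCH.

(* exp(L), as the set L with its multiplication; the associativity of bch for
   L of p-power order and class less than p is Lazard's theorem. *)
Definition lie_exp (p : nat) (L : finLieRingType) : Type := L.

HB.instance Definition _ (p : nat) (L : finLieRingType) :=
  hasMul.Build (lie_exp p L) (@bch L p).

Section FaithfulDimension.

Variables (F : fieldType) (G : magmaType).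

(* A group homomorphism to GL_d(F) is just a multiplicative map, so that only
   the multiplication of G occurs here (see faithful_reprP for the agreement
   with mx_representation). *)
Definition faithful_repr (d : nat) (rho : G -> 'M[F]_d) : Prop :=
  [/\ forall x, rho x \in unitmx,
      {morph rho : x y / (x * y)%g >-> x *m y} & injective rho].

Definition is_m_faithful (m : nat) : Prop :=
  (exists rho : G -> 'M[F]_m, faithful_repr rho) /\
  (forall d (rho : G -> 'M[F]_d), faithful_repr rho -> (m <= d)%N).

End FaithfulDimension.

Lemma faithful_reprP (F : fieldType) (gT : finGroupType) (d : nat) :
  (exists rho : gT -> 'M[F]_d, faithful_repr rho) <->
  (exists rG : mx_representation F [set: gT] d, mx_faithful rG).
Proof.
split=> [[rho [Urho Mrho Irho]] | [rG fG]].
  have rho1 : rho 1%g = 1%:M.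
    by apply: (can_inj (mulKmx (Urho 1%g))); rewrite -Mrho mulg1 mulmx1.
  have rP : mx_repr [set: gT] rho by split=> // x y _ _; apply: Mrho.
  exists (MxRepresentation rP); apply/subsetP=> x.
  rewrite inE => /andP[_ /eqP]; rewrite mul1mx /= -rho1 => /Irho ->.
  exact: set11.
exists rG; split.
- by move=> x; apply: repr_mx_unit; rewrite inE.
- by move=> x y; apply: repr_mxM; rewrite inE.
- by move=> x y; apply: (mx_faithful_inj fG); rewrite inE.
Qed.

Record strict_order (n : nat) := StrictOrder {
  prec_rel :> rel 'I_n;
  prec_irr : irreflexive prec_rel;
  prec_trans : transitive prec_rel
}.

Section StrictOrder.

Variables (n : nat) (prec : strict_order n).

(* A chain i_0 < ... < i_r has r + 1 <= n elements (see prec_length_max). *)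
Definition prec_length : nat :=
  \max_(r < n | [exists s : r.+1.-tuple 'I_n, sorted prec s]) r.

Lemma prec_length_max (r : nat) (s : r.+1.-tuple 'I_n) :
  sorted prec s -> (r <= prec_length)%N.
Proof.
move=> ss; have us := sorted_uniq (@prec_trans _ prec) (@prec_irr _ prec) ss.
have lt_rn : (r < n)%N.
  by rewrite -(size_tuple s) -[n in (_ <= n)%N]card_ord -(card_uniqP us) max_card.
rewrite /prec_length; apply: (bigmax_sup (Ordinal lt_rn)) => //=.
by apply/existsP; exists s.
Qed.

Definition prec_alpha (i j : 'I_n) : nat := #|[set k | prec i k && prec k j]|.

Definition prec_minimal (i : 'I_n) : bool := [forall k, ~~ prec k i].
Definition prec_maximal (j : 'I_n) : bool := [forall k, ~~ prec j k].

Definition extreme_pairs : {set 'I_n * 'I_n} :=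
  [set ij | [&& prec_minimal ij.1, prec_maximal ij.2 & prec ij.1 ij.2]].

End StrictOrder.

Section Pattern.

Variables (n : nat) (prec : strict_order n) (R : comNzRingType).

Definition pattern_mx : {pred 'M[R]_n} :=
  fun A => [forall i, forall j, ~~ prec i j ==> (A i j == 0)].

Lemma pattern_mx0P (A : 'M[R]_n) :
  reflect (forall i j, ~~ prec i j -> A i j = 0) (A \in pattern_mx).
Proof.
apply: (iffP forallP) => [h i j nij | h i].
  by have /forallP/(_ j)/implyP/(_ nij)/eqP := h i.
by apply/forallP=> j; apply/implyP=> nij; apply/eqP/h.
Qed.

(* pattern_mx is the R-span of the elementary matrices e_ij with i < j. *)
Lemma pattern_mx_spanP (A : 'M[R]_n) :
  reflect (exists c : 'I_n -> 'I_n -> R,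
             A = \sum_i \sum_(j | prec i j) c i j *: delta_mx i j)
          (A \in pattern_mx).
Proof.
apply: (iffP (pattern_mx0P A)) => [h | [c ->] i j nij].
  exists A; rewrite {1}[A]matrix_sum_delta; apply: eq_bigr => i _.
  rewrite [LHS](bigID (prec i)) /= [X in _ + X]big1 ?addr0 // => j nij.
  by rewrite h // scale0r.
rewrite summxE big1 // => k _; rewrite summxE big1 // => l kl.
rewrite !mxE; case: eqP => [ik|_] /=; last by rewrite mulr0.
case: eqP => [jl|_] /=; last by rewrite mulr0.
by move: nij; rewrite ik jl kl.
Qed.

Fact pattern_mx_zmod : zmod_closed pattern_mx.
Proof.
split=> [|A B /pattern_mx0P hA /pattern_mx0P hB]; apply/pattern_mx0P=> i j nij.
  by rewrite mxE.
by rewrite !mxE hA // hB // subrr.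
Qed.

HB.instance Definition _ := GRing.isZmodClosed.Build _ pattern_mx pattern_mx_zmod.

Fact pattern_mxM (A B : 'M[R]_n) :
  A \in pattern_mx -> B \in pattern_mx -> A *m B \in pattern_mx.
Proof.
move=> /pattern_mx0P hA /pattern_mx0P hB; apply/pattern_mx0P=> i j nij.
rewrite mxE big1 // => k _.
have [ik|/hA ->] := boolP (prec i k); last by rewrite mul0r.
rewrite hB ?mulr0 //; apply: contra nij; exact: prec_trans.
Qed.

(* For R = int this is the pattern Lie algebra. For general R it is its tensor
   product with R over the integers, as shown by pattern_tensorD*,
   pattern_tensor_lieb and pattern_tensor_universal below. *)
Record pattern_lie := PatternLie {
  pattern_val :> 'M[R]_n;
  pattern_valP : pattern_val \in pattern_mx
}.

HB.instance Definition _ := [isSub for pattern_val].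
HB.instance Definition _ := [Choice of pattern_lie by <:].
HB.instance Definition _ := [SubChoice_isSubZmodule of pattern_lie by <:].

HB.instance Definition _ :=
  GRing.isZmodMorphism.Build pattern_lie 'M[R]_n pattern_val (fun x y => erefl).

Fact pattern_bracket_proof (x y : pattern_lie) :
  x *m y - y *m x \in pattern_mx.
Proof. by rewrite rpredB ?pattern_mxM ?pattern_valP. Qed.

Definition pattern_bracket (x y : pattern_lie) : pattern_lie :=
  PatternLie (pattern_bracket_proof x y).

Fact pattern_bracketDl x y z :
  pattern_bracket (x + y) z = pattern_bracket x z + pattern_bracket y z.
Proof.
by apply: val_inj; rewrite /= mulmxDl mulmxDr opprD addrACA.
Qed.

Fact pattern_bracketDr x y z :
  pattern_bracket x (y + z) = pattern_bracket x y + pattern_bracket x z.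
Proof.
by apply: val_inj; rewrite /= mulmxDl mulmxDr opprD addrACA.
Qed.

Fact pattern_bracketxx x : pattern_bracket x x = 0.
Proof. by apply: val_inj; rewrite /= subrr. Qed.

Fact pattern_bracket_jacobi x y z :
  pattern_bracket x (pattern_bracket y z)
    + pattern_bracket y (pattern_bracket z x)
    + pattern_bracket z (pattern_bracket x y) = 0.
Proof.
apply: val_inj => /=; case: x y z => [A _] [B _] [C _] /=.
rewrite !mulmxBr !mulmxBl !mulmxA.
by apply/matrixP=> i j; do !rewrite [in LHS]mxE; rewrite [RHS]mxE; ring.
Qed.

HB.instance Definition _ := isLieRing.Build pattern_lie
  pattern_bracketDl pattern_bracketDr pattern_bracketxx pattern_bracket_jacobi.

End Pattern.

HB.instance Definition _ (n : nat) (prec : strict_order n) (F : finFieldType) :=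
  [Finite of pattern_lie prec F by <:].

Section BaseChange.

Variables (n : nat) (prec : strict_order n) (R : comNzRingType).
Local Notation gZ := (pattern_lie prec int).
Local Notation gR := (pattern_lie prec R).

Fact pattern_tensor_proof (x : gZ) (a : R) :
  a *: map_mx intr (x : 'M[int]_n) \in pattern_mx prec (R:=R).
Proof.
apply/pattern_mx0P=> i j nij.
by rewrite !mxE (pattern_mx0P _ _ (pattern_valP x)) // mulr0.
Qed.

Definition pattern_tensor (x : gZ) (a : R) : gR :=
  PatternLie (pattern_tensor_proof x a).

Lemma pattern_tensorDl (x y : gZ) (a : R) :
  pattern_tensor (x + y) a = pattern_tensor x a + pattern_tensor y a.
Proof. by apply: val_inj; rewrite /= map_mxD scalerDr. Qed.

Lemma pattern_tensorDr (x : gZ) (a b : R) :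
  pattern_tensor x (a + b) = pattern_tensor x a + pattern_tensor x b.
Proof. by apply: val_inj; rewrite /= scalerDl. Qed.

Lemma pattern_tensor_lieb (x y : gZ) (a b : R) :
  lieb (pattern_tensor x a) (pattern_tensor y b)
    = pattern_tensor (lieb x y) (a * b).
Proof.
apply: val_inj; rewrite /= map_mxB !map_mxM scalerBr.
by rewrite -!scalemxAl -!scalemxAr !scalerA [b * a]mulrC.
Qed.

Definition pattern_elem (S : comNzRingType) (i j : 'I_n) : pattern_lie prec S :=
  insubd (0 : pattern_lie prec S) (delta_mx i j).

Lemma val_pattern_elem (S : comNzRingType) (i j : 'I_n) :
  prec i j -> pattern_val (pattern_elem S i j) = delta_mx i j.
Proof.
move=> ij; rewrite -[LHS]/(val _) insubdK //; apply/pattern_mx0P=> k l nkl.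
by rewrite mxE; case: eqP => [ki|//]; case: eqP => [lj|//]; case/negP: nkl; rewrite ki lj.
Qed.

Lemma pattern_elem_sum (x : gR) :
  x = \sum_i \sum_(j | prec i j) pattern_tensor (pattern_elem int i j) (x i j).
Proof.
apply: val_inj; rewrite [RHS](raddf_sum (@pattern_val n prec R)).
rewrite {1}[val x]matrix_sum_delta; apply: eq_bigr => i _.
rewrite raddf_sum [LHS](bigID (prec i)) /= [X in _ + X]big1 ?addr0.
  apply: eq_bigr => j ij; rewrite /= val_pattern_elem //; congr (_ *: _).
  by apply/matrixP=> k l; rewrite !mxE; case: (_ && _).
by move=> j nij; rewrite (pattern_mx0P _ _ (pattern_valP x)) // scale0r.
Qed.

Lemma pattern_elem_sum_int (x : gZ) :
  x = \sum_i \sum_(j | prec i j) pattern_elem int i j *~ x i j.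
Proof.
apply: val_inj; rewrite [RHS](raddf_sum (@pattern_val n prec int)).
rewrite {1}[val x]matrix_sum_delta; apply: eq_bigr => i _.
rewrite raddf_sum [LHS](bigID (prec i)) /= [X in _ + X]big1 ?addr0.
  apply: eq_bigr => j ij; rewrite (raddfMz (@pattern_val n prec int)).
  by rewrite /= val_pattern_elem // -scaler_int intz.
by move=> j nij; rewrite (pattern_mx0P _ _ (pattern_valP x)) // scale0r.
Qed.

Lemma pattern_tensor_universal (V : zmodType) (b : gZ -> R -> V) :
    (forall x y a, b (x + y) a = b x a + b y a) ->
    (forall x a c, b x (a + c) = b x a + b x c) ->
  exists h : {additive gR -> V},
    (forall x a, h (pattern_tensor x a) = b x a) /\
    (forall h' : {additive gR -> V},
       (forall x a, h' (pattern_tensor x a) = b x a) -> h' =1 h).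
Proof.
move=> bDl bDr.
have blB a : zmod_morphism (b^~ a).
  move=> x y; apply: (addIr (b y a)); rewrite -bDl !subrK.
  by [].
have brB x : zmod_morphism (b x).
  by move=> a c; apply: (addIr (b x c)); rewrite -bDr !subrK.
pose bl a : {additive gZ -> V} :=
  HB.pack (b^~ a) (GRing.isZmodMorphism.Build gZ V (b^~ a) (blB a)).
pose br x : {additive R -> V} :=
  HB.pack (b x) (GRing.isZmodMorphism.Build R V (b x) (brB x)).
pose hf (x : gR) := \sum_i \sum_(j | prec i j) b (pattern_elem int i j) (x i j).
have hfB : zmod_morphism hf.
  move=> x y; rewrite /hf -sumrB; apply: eq_bigr => i _.
  by rewrite -sumrB; apply: eq_bigr => j _; rewrite !mxE brB.
pose hfA := GRing.isZmodMorphism.Build gR V hf hfB.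
pose h : {additive gR -> V} := HB.pack hf hfA.
have hP x a : h (pattern_tensor x a) = b x a.
  have -> : b x a = bl a x by [].
  rewrite [x in RHS](pattern_elem_sum_int x) raddf_sum; apply: eq_bigr => i _.
  rewrite raddf_sum; apply: eq_bigr => j _ /=.
  rewrite !mxE mulrzr -[LHS]/(br _ _) raddfMz /=.
  by rewrite -[b (_ *~ _) a]/(bl a _) raddfMz.
exists h; split=> // h' h'P x.
rewrite [x]pattern_elem_sum !raddf_sum; apply: eq_bigr => i _.
by rewrite !raddf_sum; apply: eq_bigr => j _; rewrite h'P hP.
Qed.

End BaseChange.

(* Main.v *)
(* Exponential. In the algebra of pattern matrices all products of p factors
   vanish, so e^x and log(1 + x) make sense up to degree p - 1, and e^x - 1 is a
   bijection of L. For Dynkin's formula replace x, y by tx, ty: if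
   e^Z = e^(tx) e^(ty), the derivation t d/dt gives
     tZ' = log(w)/(w - 1) (tx + e^(ad tx) ty),  w = e^(ad tx) e^(ad ty),
   whose expansion is t d/dt of Dynkin's series, and t d/dt is injective in
   degrees 1, ..., p - 1. Hence exp(L) is the group of unitriangular matrices
   1 + L.

   Upper bound. For an extreme pair (i, j), the group 1 + L acts on the right on
   the rows e_i + r with r supported strictly between i and j, and the j-th
   coordinate is an additive cocycle. Composed with the f coordinate characters
   of F over F_p it gives f monomial representations of dimension q^alpha(i, j),
   which are jointly faithful.

   Lower bound. The e_ij with (i, j) extreme span a central subgroup. The central
   characters occurring in a faithful representation span the dual F_p-space, so a
   nonzero term of a determinant matches the f |I_ex| coordinates with distinct
   occurring characters, each nontrivial on its coordinate. If such a character is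
   nontrivial on the coordinate (i, j), the Heisenberg subgroup generated by the
   e_ik and e_kj forces its eigenspace to have dimension at least q^alpha(i, j). *)
From HB Require Import structures.
Require Import Defs.
From mathcomp Require Import all_boot all_order all_algebra all_fingroup all_field.
From mathcomp Require Import ring.

Set Implicit Arguments.
Unset Strict Implicit.
Unset Printing Implicit Defensive.

Import GRing.Theory Num.Theory.
Local Open Scope ring_scope.

(** * Truncated exponential and logarithm over a field in which 1, ..., p - 1 are invertible *)

Section TruncatedSeries.

Variables (F : fieldType) (p : nat).
Hypothesis p_gt1 : (1 < p)%N.
Hypothesis natF_neq0 : forall k, (0 < k < p)%N -> k%:R != 0 :> F.

(* Truncations of e^X, log(1 + X), (e^X - 1)/X and log(1 + X)/X. *)
Definition expp : {poly F} := \poly_(k < p) (k`!)%:R^-1.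
(* The coefficient at k = 0 is 0 because 0^-1 = 0. *)
Definition logp : {poly F} := \poly_(k < p) ((-1) ^+ k.-1 / k%:R).
Definition phip : {poly F} := \poly_(k < p.-1) (k.+1`!)%:R^-1.
Definition psip : {poly F} := \poly_(k < p.-1) ((-1) ^+ k / k.+1%:R).

Lemma factF_neq0 k : (k < p)%N -> (k`!)%:R != 0 :> F.
Proof.
elim: k => [|k IHk] kp; first by rewrite fact0 oner_eq0.
by rewrite factS natrM mulf_neq0 ?IHk ?(ltnW kp) ?natF_neq0.
Qed.

Lemma phip_expp : 'X * phip = expp - 1.
Proof.
apply/polyP => -[|k]; rewrite coefXM coefB coef1 !coef_poly /=.
  by rewrite (ltnW p_gt1) fact0 invr1 subrr.
by rewrite subr0 ltn_predRL.
Qed.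

Lemma psip_logp : 'X * psip = logp.
Proof.
apply/polyP => -[|k]; rewrite coefXM !coef_poly /=.
  by rewrite (ltnW p_gt1) invr0 mulr0.
by rewrite ltn_predRL.
Qed.

Lemma coef_dvdXn (n k : nat) (q : {poly F}) : 'X^n %| q -> (k < n)%N -> q`_k = 0.
Proof. by move=> /dvdpP[r ->] kn; rewrite coefMXn kn. Qed.

Lemma dvdXnP (n : nat) (q : {poly F}) :
  reflect (forall k, (k < n)%N -> q`_k = 0) ('X^n %| q).
Proof.
apply: (iffP idP) => [nq k|q0]; first exact: coef_dvdXn.
apply/dvdpP; exists (drop_poly n q).
rewrite -[LHS](poly_take_drop n) [X in X + _](_ : _ = 0) ?add0r //.
by apply/polyP => k; rewrite coef_take_poly coef0; case: ltnP => // /q0.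
Qed.

Lemma dvdX_expp1 : 'X %| expp - 1.
Proof. by rewrite -phip_expp dvdp_mulr. Qed.

Lemma deriv_expp : 'X^(p.-1) %| expp^`() - expp.
Proof.
apply/dvdXnP => k kp; have kp' : (k.+1 < p)%N by rewrite -ltn_predRL.
rewrite coefB coef_deriv !coef_poly kp' (ltnW kp') -[X in X - _]mulr_natr factS natrM.
by rewrite invfM mulrAC mulVf ?mul1r ?subrr // natF_neq0.
Qed.

(** The derivative is a geometric sum in [- 'X], which telescopes against ['X + 1]. *)
Lemma deriv_logp : logp^`() * ('X + 1) = 1 - (- 'X) ^+ p.-1.
Proof.
have -> : logp^`() = \sum_(k < p.-1) (- 'X) ^+ k.
  transitivity (\poly_(k < p.-1) ((-1) ^+ k : F)).
    apply/polyP => k; rewrite coef_deriv !coef_poly -[LHS]mulr_natr -ltn_predRL.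
    case: ifP => kp; rewrite ?mul0r // divfK // natF_neq0 //.
    by rewrite -ltn_predRL.
  rewrite poly_def; apply: eq_bigr => k _.
  by rewrite -[LHS]mul_polyC polyC_exp polyCN -exprMn mulN1r.
rewrite mulrC -[X in _ = X]opprB subrX1 -mulNr; congr (_ * _).
by rewrite opprB opprK addrC.
Qed.

(** The difference has zero constant term, and by the chain rule its derivative vanishes below
    degree p - 1. Since 1, ..., p - 1 are invertible, its coefficients below degree p can be
    recovered from the derivative. *)
Lemma expp_logpE : 'X^p %| (logp \Po (expp - 1)) - 'X.
Proof.
set g := _ - 'X; have g0 : g`_0 = 0.
  rewrite coefB coefX subr0 -horner_coef0 horner_comp hornerD hornerN hornerC.
  rewrite !horner_coef0 coef_poly (ltnW p_gt1) fact0 invr1 subrr horner_coef0.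
  by rewrite coef_poly (ltnW p_gt1) invr0 mulr0.
have dg : 'X^(p.-1) %| g^`().
  rewrite derivB deriv_comp derivX derivB derivC subr0.
  set l := logp^`() \Po _.
  have -> : l * expp^`() - 1 = l * (expp^`() - expp) + (l * expp - 1) by ring.
  apply: dvdp_add; first by rewrite dvdp_mull // deriv_expp.
  have -> : l * expp = (logp^`() * ('X + 1)) \Po (expp - 1).
    by rewrite comp_polyM comp_polyD comp_polyX comp_polyC subrK.
  rewrite deriv_logp comp_polyB comp_polyC addrAC subrr add0r dvdpNr.
  rewrite (rmorphXn (comp_poly _)) rmorphN /= comp_polyX.
  by rewrite exprNn dvdp_mull // dvdp_exp2r ?dvdX_expp1.
apply/dvdXnP => -[//|k] kp; have := coef_dvdXn dg (_ : k < p.-1)%N.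
rewrite ltn_predRL => /(_ kp)/eqP; rewrite coef_deriv -[X in X == _]mulr_natr mulf_eq0.
by rewrite (negPf (natF_neq0 _)) ?orbF //= => /eqP.
Qed.

(** The difference h satisfies h(0) = 0 and (1 + X) h' = h modulo X^(p-1). This recursion determines
    each coefficient below degree p from the preceding one, so all of them vanish. *)
Lemma logp_exppE : 'X^p %| (expp \Po logp) - (1 + 'X).
Proof.
set h := _ - (_ + _); have h0 : h`_0 = 0.
  rewrite coefB coefD coefC coefX addr0 -horner_coef0 horner_comp.
  rewrite horner_coef0 coef_poly (ltnW p_gt1) invr0 mulr0.
  by rewrite horner_coef0 coef_poly (ltnW p_gt1) fact0 invr1 subrr.
have dh : 'X^(p.-1) %| h^`() * ('X + 1) - h.
  rewrite derivB deriv_comp derivD derivX derivC add0r.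
  set e' := expp^`() \Po _.
  have -> : (e' * logp^`() - 1) * ('X + 1) - h =
     e' * (logp^`() * ('X + 1) - 1) + (e' - (expp \Po logp)) by rewrite /h; ring.
  apply: dvdp_add.
    rewrite deriv_logp addrAC subrr add0r dvdp_mull // dvdpNr exprNn.
    by rewrite dvdp_mull.
  rewrite -comp_polyB; apply: dvdp_trans (dvdp_comp_poly logp deriv_expp).
  rewrite (rmorphXn (comp_poly _)) /= comp_polyX dvdp_exp2r //.
  by rewrite -psip_logp dvdp_mulr.
apply/dvdXnP; elim=> [//|k IHk] kp; have := coef_dvdXn dh (_ : k < p.-1)%N.
rewrite ltn_predRL => /(_ kp)/eqP; rewrite coefB mulrDr mulr1 coefD coefMX.
rewrite !coef_deriv (IHk (ltnW kp)) subr0.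
have -> : (if k == 0%N then 0 else h`_k.-1.+1 *+ k.-1.+1) = 0.
  by case: k kp IHk => //= k kp IHk; rewrite IHk ?mul0rn // ltnW.
rewrite add0r -[X in X == _]mulr_natr mulf_eq0.
by rewrite (negPf (natF_neq0 _)) ?orbF //= => /eqP.
Qed.

(** Dividing [expp_logpE] by ['X] costs one degree. With w = e^X it says that log(w)/(w - 1) and
    (e^X - 1)/X are mutually inverse, which later inverts [phip] at the operator [adj z]. *)
Lemma phip_psipE : 'X^(p.-1) %| (psip \Po (expp - 1)) * phip - 1.
Proof.
rewrite -(@dvdp_mul2l _ 'X) ?polyX_eq0 // -exprS prednK ?(ltnW p_gt1) //.
have -> : 'X * ((psip \Po (expp - 1)) * phip - 1) = (logp \Po (expp - 1)) - 'X.
  rewrite -psip_logp comp_polyM comp_polyX; set q := psip \Po _.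
  by rewrite -phip_expp; ring.
exact: expp_logpE.
Qed.

End TruncatedSeries.

(** * Polynomials evaluated at a linear operator *)

Section OperatorPolynomials.

Variables (F : fieldType) (V : lmodType F).
Implicit Types (T : {linear V -> V}) (q r : {poly F}) (v : V).

Definition opoly T q v : V := \sum_(i < size q) q`_i *: iter i T v.

Lemma opolyE T n q v :
  (size q <= n)%N -> opoly T q v = \sum_(i < n) q`_i *: iter i T v.
Proof.
move=> qn; rewrite /opoly (big_ord_widen n (fun i => q`_i *: iter i T v)) //.
rewrite big_mkcond /=.
apply: eq_bigr => i _; case: ltnP => // qi.
by rewrite nth_default // scale0r.
Qed.

Fact iter_is_linear T n : linear (iter n T).
Proof.
elim: n => //= n IHn a u v.
by rewrite !iterS -linearP; congr (T _); apply: IHn.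
Qed.

HB.instance Definition _ T n :=
  GRing.isLinear.Build F V V _ (iter n T) (iter_is_linear T n).

Fact opoly_is_linear T q : linear (opoly T q).
Proof.
move=> a u v; rewrite /opoly scaler_sumr -big_split /=; apply: eq_bigr => i _.
by rewrite iter_is_linear scalerDr !scalerA mulrC.
Qed.
HB.instance Definition _ T q :=
  GRing.isLinear.Build F V V _ (opoly T q) (opoly_is_linear T q).

Lemma opolyD T q r v : opoly T (q + r) v = opoly T q v + opoly T r v.
Proof.
pose n := maxn (size q) (size r).
rewrite !(@opolyE _ n) ?leq_maxl ?leq_maxr ?size_polyD //.
by rewrite -big_split; apply: eq_bigr => i _; rewrite coefD scalerDl.
Qed.

Lemma opolyZ T c q v : opoly T (c *: q) v = c *: opoly T q v.
Proof.
rewrite (@opolyE _ (size q)) ?size_scale_leq // /opoly scaler_sumr.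
by apply: eq_bigr => i _; rewrite coefZ scalerA.
Qed.

Lemma opolyC T c v : opoly T c%:P v = c *: v.
Proof.
rewrite (@opolyE _ 1) ?size_polyC_leq1 // big_ord1 coefC //.
Qed.

Lemma opolyMX T q v : opoly T (q * 'X) v = opoly T q (T v).
Proof.
rewrite (@opolyE _ (size q).+1) ?(leq_trans (size_polyMleq _ _)) ?size_polyX ?addn2 //.
rewrite big_ord_recl coefMX scale0r add0r; apply: eq_bigr => i _.
by rewrite coefMX /= -iterS iterSr.
Qed.

Lemma opolyM T q r v : opoly T (q * r) v = opoly T q (opoly T r v).
Proof.
elim/poly_ind: q r v => [|q c IHq] r v; first by rewrite mul0r /opoly size_poly0 !big_ord0.
rewrite mulrDl !opolyD opolyC mul_polyC opolyZ -mulrA ['X * r]mulrC IHq opolyMX opolyMX.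
congr (opoly T q _ + _).
elim/poly_ind: r v => [|r d IHr] v; first by rewrite /opoly size_poly0 !big_ord0 linear0.
by rewrite !opolyD !opolyC !opolyMX linearD linearZ IHr.
Qed.

Lemma opoly_comp T (S : {linear V -> V}) q r v :
  (forall u, S u = opoly T r u) -> opoly T (q \Po r) v = opoly S q v.
Proof.
move=> ST; elim/poly_ind: q v => [|q c IHq] v.
  by rewrite comp_poly0 /opoly size_poly0 !big_ord0.
by rewrite comp_poly_MXaddC !opolyD opolyMX !opolyC opolyM IHq ST.
Qed.

Lemma opoly_dvdXn T n q v : iter n T v = 0 -> 'X^n %| q -> opoly T q v = 0.
Proof.
move=> Tn /dvdpP[r ->]; rewrite opolyM (_ : opoly T 'X^n v = 0) ?linear0 // -Tn.
elim: n v {Tn} => [|n IHn] v; first by rewrite opolyC scale1r.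
by rewrite exprSr opolyMX IHn -iterSr.
Qed.

End OperatorPolynomials.

Lemma horner_alg_comp (F : fieldType) (A : algType F) (a : A) (q r : {poly F}) :
  horner_alg a (q \Po r) = horner_alg (horner_alg a r) q.
Proof.
elim/poly_ind: q => [|q c IHq]; first by rewrite comp_poly0 !rmorph0.
by rewrite comp_poly_MXaddC !rmorphD !rmorphM /= IHq !horner_algC horner_algX.
Qed.

(** The triangular sum misses exactly the products with i + j >= n, and the hypothesis makes these
    zero. *)
Lemma sum_convolution (A : pzRingType) n (a d : nat -> A) :
    (forall i j, (i < n)%N -> (j < n)%N -> (n <= i + j)%N -> a i * d j = 0) ->
  \sum_(m < n) \sum_(i < m.+1) a i * d (m - i)%N =
    (\sum_(i < n) a i) * (\sum_(j < n) d j).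
Proof.
move=> ad0; rewrite mulr_suml.
transitivity (\sum_(m < n) \sum_(i < n | (i <= m)%N) a i * d (m - i)%N).
  apply: eq_bigr => m _.
  by rewrite (big_ord_widen n (fun i => a i * d (m - i)%N)).
rewrite (exchange_big_dep xpredT) //=; apply: eq_bigr => i _; rewrite mulr_sumr.
transitivity (\sum_(i <= m < n) a i * d (m - i)%N).
  by rewrite (big_geq_mkord i n (fun=> true) (fun m => a i * d (m - i)%N)).
rewrite -{1}[nat_of_ord i]add0n big_addn big_mkord.
under eq_bigr do rewrite addnK.
rewrite (big_ord_widen n (fun j => a i * d j)) ?leq_subr // big_mkcond /=.
apply: eq_bigr => j _; case: ltnP => // ij; rewrite ad0 //.
by rewrite -leq_subLR.
Qed.

(** * Exponentials in an algebra with a descending filtration [J] whose p-th step is zero *)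

Section GradedNilpotent.

Variables (F : fieldType) (p : nat).
Hypothesis p_gt1 : (1 < p)%N.
Hypothesis natF_neq0 : forall k, (0 < k < p)%N -> k%:R != 0 :> F.

Variables (A : algType F) (J : nat -> A -> Prop).
Hypothesis JD : forall k x y, J k x -> J k y -> J k (x + y).
Hypothesis JZ : forall k c x, J k x -> J k (c *: x).
Hypothesis J_1 : J 0 1.
Hypothesis JM : forall i j x y, J i x -> J j y -> J (i + j) (x * y).
Hypothesis JW : forall k x, J k.+1 x -> J k x.
Hypothesis Jp : forall x, J p x -> x = 0.

Implicit Types (x y z v w : A) (q r : {poly F}).

Definition adj z v := z * v - v * z.

Fact adj_is_linear z : linear (adj z).
Proof.
move=> a u v; rewrite /adj mulrDr mulrDl -scalerAr -scalerAl scalerBr opprD.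
by rewrite addrACA.
Qed.
HB.instance Definition _ z :=
  GRing.isLinear.Build F A A _ (adj z) (adj_is_linear z).

Definition texp z := horner_alg z (expp F p).

Lemma JN k x : J k x -> J k (- x).
Proof. by move=> Jx; rewrite -scaleN1r; apply: JZ. Qed.

Lemma JB k x y : J k x -> J k y -> J k (x - y).
Proof. by move=> Jx Jy; apply: JD => //; apply: JN. Qed.

Lemma JX z k : J 1 z -> J k (z ^+ k).
Proof. by move=> Jz; elim: k => // k IHk; rewrite exprS -add1n; apply: JM. Qed.

Lemma J_leq k l x : (k <= l)%N -> J l x -> J k x.
Proof. by move=> /subnK <-; elim: (l - k)%N => // m IHm /JW. Qed.

Lemma J_big0 k x : (p <= k)%N -> J k x -> x = 0.
Proof. by move=> pk /(J_leq pk)/Jp. Qed.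

Lemma J_horner z q : J 1 z -> J 0 (horner_alg z q).
Proof.
move=> Jz; elim/poly_ind: q => [|q c IHq]; first by rewrite rmorph0 -(scale0r 1); apply: JZ.
rewrite rmorphD rmorphM /= horner_algC horner_algX.
by apply: JD; [apply/JW; rewrite -[1%N]add0n; apply: JM | apply: JZ].
Qed.

Lemma J_horner_dvdXn n z q : J 1 z -> 'X^n %| q -> J n (horner_alg z q).
Proof.
move=> Jz /dvdpP[r ->]; rewrite rmorphM rmorphXn /= horner_algX -[n]add0n.
by apply: JM; [apply: J_horner | apply: JX].
Qed.

Lemma J_adj k z v : J 1 z -> J k v -> J k.+1 (adj z v).
Proof.
move=> Jz Jv; apply: JB; first by rewrite -add1n; apply: JM.
by rewrite -addn1; apply: JM.
Qed.

Lemma J_iter_adj k n z v : J 1 z -> J k v -> J (n + k) (iter n (adj z) v).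
Proof. by move=> Jz Jv; elim: n => //= n IHn; apply: J_adj. Qed.

Lemma texp1_J z : J 1 z -> J 1 (texp z - 1).
Proof.
move=> Jz; rewrite -[1 in X in J _ X](rmorph1 (horner_alg z)) -rmorphB /=.
by apply: (J_horner_dvdXn Jz); rewrite expr1 dvdX_expp1.
Qed.

(** The witness is the truncated logarithm of [u]: the error in [logp_exppE] is divisible by X^p,
    hence vanishes at [u - 1], which lies in [J 1]. *)
Lemma texp_surj u : J 1 (u - 1) -> exists2 z, J 1 z & texp z = u.
Proof.
move=> Ju; exists (horner_alg (u - 1) (logp F p)).
  by apply: (J_horner_dvdXn Ju); rewrite expr1 -psip_logp ?dvdp_mulr.
rewrite /texp -horner_alg_comp; set w := u - 1.
have -> : u = horner_alg w (1 + 'X) by rewrite rmorphD rmorph1 /= horner_algX subrKC.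
apply/eqP; rewrite -subr_eq0 -rmorphB; apply/eqP/Jp.
exact/(J_horner_dvdXn Ju)/logp_exppE.
Qed.

Lemma texp_inj z1 z2 : J 1 z1 -> J 1 z2 -> texp z1 = texp z2 -> z1 = z2.
Proof.
have logK z : J 1 z -> horner_alg (texp z - 1) (logp F p) = z.
  move=> Jz; rewrite -[1 in X in horner_alg X _](rmorph1 (horner_alg z)) -rmorphB.
  rewrite -horner_alg_comp -[RHS]horner_algX; apply/eqP; rewrite -subr_eq0 -rmorphB.
  exact/eqP/Jp/(J_horner_dvdXn Jz)/expp_logpE.
by move=> J1z J2z /(congr1 (fun w => horner_alg (w - 1) (logp F p))); rewrite !logK.
Qed.

(** The hypothesis gives w = - w (e^z - 1) with e^z - 1 in [J 1]; iterating pushes [w] into [J p].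
    This serves to cancel e^z on the right of equations. *)
Lemma texp_rreg z w : J 0 w -> J 1 z -> w * texp z = 0 -> w = 0.
Proof.
move=> Jw Jz wE; have /JN Ju := texp1_J Jz; apply: Jp.
have ew : w = w * - (texp z - 1) by rewrite mulrN mulrBr wE mulr1 sub0r opprK.
elim: p => // k Jk; rewrite ew -addn1; exact: JM.
Qed.

Definition dpow z k : A := (k`!)%:R^-1 *: z ^+ k.
Definition adpow z v k : A := (k`!)%:R^-1 *: iter k (adj z) v.

Lemma horner_alg_poly z n (c : nat -> F) :
  horner_alg z (\poly_(k < n) c k) = \sum_(k < n) c k *: z ^+ k.
Proof.
rewrite poly_def rmorph_sum; apply: eq_bigr => k _ /=.
by rewrite -mul_polyC rmorphM rmorphXn /= horner_algC horner_algX mulr_algl.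
Qed.

Lemma opoly_poly (T : {linear A -> A}) v n (c : nat -> F) :
  opoly T (\poly_(k < n) c k) v = \sum_(k < n) c k *: iter k T v.
Proof.
rewrite (opolyE _ _ (size_poly n c)); apply: eq_bigr => i _.
by rewrite coef_poly ltn_ord.
Qed.

Lemma mul_factVS k : (k.+1 < p)%N -> k.+1%:R * (k.+1`!)%:R^-1 = (k`!)%:R^-1 :> F.
Proof.
by move=> kp; rewrite factS natrM invfM mulrA mulfV ?mul1r // natF_neq0.
Qed.

Lemma scale_dpow z k : (k.+1 < p)%N -> k.+1%:R *: dpow z k.+1 = z * dpow z k.
Proof. by move=> kp; rewrite /dpow scalerA mul_factVS // exprS -scalerAr. Qed.

Lemma scale_adpow z v k : (k.+1 < p)%N -> k.+1%:R *: adpow z v k.+1 = adj z (adpow z v k).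
Proof. by move=> kp; rewrite /adpow scalerA mul_factVS // linearZ. Qed.

Lemma mul_adjE z v : z * v = adj z v + v * z.
Proof. by rewrite /adj subrK. Qed.

(** Induction on m after multiplying by m + 1: one more factor [z] is moved to the right past
    [adpow z v i] by [mul_adjE]. *)
Lemma dpow_mul z v m :
  (m < p)%N -> dpow z m * v = \sum_(i < m.+1) adpow z v i * dpow z (m - i).
Proof.
elim: m => [|m IHm] mp.
  by rewrite big_ord1 /dpow /adpow !fact0 invr1 !scale1r expr0 mul1r mulr1.
apply: (scalerI (natF_neq0 (_ : 0 < m.+1 < p)%N)) => //.
rewrite scalerAl scale_dpow // -mulrA IHm ?(ltnW mp) // mulr_sumr scaler_sumr.
transitivity (\sum_(i < m.+1) i.+1%:R *: (adpow z v i.+1 * dpow z (m - i))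
    + \sum_(i < m.+1) (m.+1 - i)%:R *: (adpow z v i * dpow z (m.+1 - i))).
  rewrite -big_split /=; apply: eq_bigr => i _; have im := ltn_ord i.
  rewrite mulrA [z * _]mul_adjE mulrDl -scale_adpow ; last by apply: leq_ltn_trans mp.
  congr (_ + _); first by rewrite [RHS]scalerAl.
  rewrite -mulrA -scale_dpow; first by rewrite subSn // [RHS]scalerAr.
  by apply: leq_ltn_trans mp; rewrite ltnS leq_subr.
(* The weight m + 1 is shared as i + (m + 1 - i): the first share comes from raising the index of
   [adpow], the second from raising that of [dpow]. *)
have e2 (i : 'I_m.+2) (w : A) : m.+1%:R *: w = i%:R *: w + (m.+1 - i)%:R *: w.
  by rewrite -scalerDl -natrD subnKC // -ltnS.
rewrite [RHS](eq_bigr _ (fun i _ => e2 i _)) big_split /=; congr (_ + _).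
  by rewrite [RHS]big_ord_recl /= scale0r add0r; apply: eq_bigr => i _.
by rewrite [RHS]big_ord_recr /= subnn scale0r addr0.
Qed.

Lemma J_dpow z k : J 1 z -> J k (dpow z k).
Proof. by move=> Jz; apply/JZ/JX. Qed.

(* With divided powers, this is the identity e^z v = (e^(ad z) v) e^z. *)
Lemma texp_mul z v :
  J 1 z -> J 0 v -> texp z * v = opoly (adj z) (expp F p) v * texp z.
Proof.
move=> Jz Jv; rewrite /texp horner_alg_poly opoly_poly.
rewrite -[RHS](@sum_convolution _ p (adpow z v) (dpow z)).
  by rewrite mulr_suml; apply: eq_bigr => m _; apply: dpow_mul.
move=> i j _ _ pij; apply: (J_big0 pij); apply: JM; last exact: J_dpow.
by apply/JZ/(@J_leq _ (i + 0)); [rewrite addn0 | apply: J_iter_adj].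
Qed.

Variable delta : {linear A -> A}.
Hypothesis deltaM : forall x y, delta (x * y) = delta x * y + x * delta y.
Hypothesis Jdelta : forall k x, J k x -> J k (delta x).

(** The terms of (e^(ad z) - 1)/(ad z) applied to [delta z]. *)
Definition adpow1 z k : A := (k.+1`!)%:R^-1 *: iter k (adj z) (delta z).

Lemma delta1 : delta 1 = 0.
Proof.
by apply: (addrI (delta 1)); rewrite addr0 -{3}[1]mulr1 deltaM mulr1 mul1r.
Qed.

Lemma scale_adpow1 z k : (k.+2 < p)%N -> k.+2%:R *: adpow1 z k.+1 = adj z (adpow1 z k).
Proof. by move=> kp; rewrite /adpow1 scalerA mul_factVS // linearZ. Qed.

Lemma delta_dpow z m :
  (m.+1 < p)%N -> delta (dpow z m.+1) = \sum_(i < m.+1) adpow1 z i * dpow z (m - i).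
Proof.
elim: m => [|m IHm] mp.
  rewrite big_ord1 /dpow /adpow1 subnn fact0 (_ : 1`! = 1%N) //= !invr1 !scale1r.
  by rewrite expr0 expr1 mulr1.
apply: (scalerI (natF_neq0 (_ : 0 < m.+2 < p)%N)) => //.
rewrite -linearZ scale_dpow //= deltaM IHm ?(ltnW mp) // mulr_sumr scaler_sumr.
transitivity (delta z * dpow z m.+1 +
   (\sum_(i < m.+1) i.+2%:R *: (adpow1 z i.+1 * dpow z (m - i))
    + \sum_(i < m.+1) (m.+1 - i)%:R *: (adpow1 z i * dpow z (m.+1 - i)))).
  rewrite -big_split /=; congr (_ + _); apply: eq_bigr => i _; have im := ltn_ord i.
  rewrite mulrA [z * _]mul_adjE mulrDl -scale_adpow1 ; last by apply: leq_ltn_trans mp.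
  congr (_ + _); first by rewrite [RHS]scalerAl.
  rewrite -mulrA -scale_dpow; first by rewrite subSn // [RHS]scalerAr.
  by apply: ltnW; apply: leq_ltn_trans mp; rewrite !ltnS leq_subr.
have e2 (i : 'I_m.+2) (w : A) : m.+2%:R *: w = i.+1%:R *: w + (m.+1 - i)%:R *: w.
  by rewrite -scalerDl -natrD addSn subnKC // -ltnS.
rewrite [RHS](eq_bigr _ (fun i _ => e2 i _)) big_split addrA /=; congr (_ + _).
  rewrite [RHS]big_ord_recl /= scale1r subn0; congr (_ + _).
  by rewrite /adpow1 /= (_ : 1`! = 1%N) // invr1 scale1r.
by rewrite [RHS]big_ord_recr /= subnn scale0r addr0.
Qed.

(** This is the differential of the exponential, obtained by summing [delta_dpow] as a Cauchy
    product. *)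
Lemma delta_texp z :
  J 1 z -> delta (texp z) = opoly (adj z) (phip F p) (delta z) * texp z.
Proof.
move=> Jz; rewrite /texp horner_alg_poly opoly_poly.
have pE : p = p.-1.+1 by rewrite prednK // ltnW.
have sumS (g : nat -> A) : \sum_(k < p) g k = \sum_(k < p.-1.+1) g k by rewrite -pE.
rewrite [X in delta X](sumS (dpow z)) big_ord_recl linearD linearZ /= expr0 delta1.
rewrite scaler0 add0r linear_sum.
transitivity (\sum_(m < p.-1) \sum_(i < m.+1) adpow1 z i * dpow z (m - i)).
  by apply: eq_bigr => m _; rewrite -delta_dpow // -ltn_predRL.
have J_adpow1 i : J i.+1 (adpow1 z i).
  apply/JZ/(@J_leq _ (i + 1)); first by rewrite addn1.
  by apply: J_iter_adj => //; apply: Jdelta.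
transitivity ((\sum_(i < p.-1) adpow1 z i) * (\sum_(k < p) dpow z k)); last by [].
rewrite sum_convolution => [|i j _ _ pij].
  (* The exponential has one term more than the convolution; that term has degree p - 1 and
     multiplies elements of [J 1], so it contributes nothing. *)
  rewrite (sumS (dpow z)).
  rewrite [in RHS]big_ord_recr /= mulrDr [X in _ = _ + X]mulr_suml.
  rewrite [X in _ = _ + X]big1 ?addr0 // => i _; apply: (@J_big0 (i.+1 + p.-1)).
    by rewrite addSn -addnS -pE leq_addl.
  by apply: JM; [apply: J_adpow1 | apply: J_dpow].
apply: (@J_big0 (i.+1 + j)); first by rewrite addSn pE ltnS.
by apply: JM; [apply: J_adpow1 | apply: J_dpow].
Qed.

(* If e^Z = e^X e^Y and X, Y are homogeneous of degree 1 for the Euler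
   derivation delta, this is delta Z = log(w)/(w - 1) (X + e^(ad X) Y) with
   w = e^(ad X) e^(ad Y). *)
Lemma delta_log_texpM x y z :
    J 1 x -> J 1 y -> J 1 z -> delta x = x -> delta y = y ->
    texp z = texp x * texp y ->
  let w v := opoly (adj x) (expp F p) (opoly (adj y) (expp F p) v) in
  delta z = \sum_(k < p.-1) ((-1) ^+ k / k.+1%:R) *:
              iter k (fun v => w v - v) (x + opoly (adj x) (expp F p) y).
Proof.
move=> Jx Jy Jz dx dy zE w; set W := x + _.
have JO k v (q : {poly F}) t : J 1 t -> J k v -> J k (opoly (adj t) q v).
  move=> Jt Jv; rewrite /opoly; elim/big_rec: _ => [|i u _ Ju].
    by rewrite -(scale0r v); apply: JZ.
  by apply: JD => //; apply/JZ/(@J_leq _ (i + k)); [exact: leq_addl | exact: J_iter_adj].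
have phiX t : delta t = t -> opoly (adj t) (phip F p) (delta t) = t.
  move=> ->; rewrite opoly_poly; have : (0 < p.-1)%N by rewrite ltn_predRL.
  case: p.-1 => // m _; rewrite big_ord_recl /= (_ : 1`! = 1%N) // invr1 scale1r big1 ?addr0 // => i _.
  by rewrite -iterS iterSr /= {2}/adj subrr linear0 ?scaler0.
(* After multiplication by e^z on the right, both sides compute [delta (texp x * texp y)]. *)
have psiW : opoly (adj z) (phip F p) (delta z) = W.
  apply/eqP; rewrite -subr_eq0; apply/eqP; apply: (texp_rreg _ Jz).
    by apply/JB; [|apply/JD]; do ?[apply: JO => //]; do ?apply: Jdelta; apply: JW.
  rewrite mulrBl -delta_texp // zE deltaM !delta_texp // !phiX // /W mulrDl !mulrA.
  by rewrite -texp_mul ?subrr //; apply: JW.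
(* Conjugation by e^z is conjugation by e^y followed by conjugation by e^x. *)
have wE v : J 0 v -> opoly (adj z) (expp F p) v = w v.
  move=> Jv; apply/eqP; rewrite -subr_eq0; apply/eqP; apply: (texp_rreg _ Jz).
    by rewrite /w; apply: JB; apply/JO => //; apply/JO.
  rewrite /w mulrBl -texp_mul // zE mulrA -texp_mul; last exact: JO; last by [].
  by rewrite -!mulrA -texp_mul // subrr.
(* [phip_psipE] inverts [phip] at [adj z]; the error, divisible by X^(p-1), kills [delta z] because
   the latter lies in [J 1]. *)
have -> : delta z = opoly (adj z) (psip F p \Po (expp F p - 1)) W.
  rewrite -psiW -opolyM; set q := _ * _.
  rewrite -[q](subrK 1) opolyD opolyC scale1r (@opoly_dvdXn _ _ _ p.-1) ?add0r //.
    apply: (@J_big0 (p.-1 + 1)); first by rewrite addn1 prednK // ltnW.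
    by apply: J_iter_adj => //; apply: Jdelta.
  exact: phip_psipE.
rewrite (@opoly_comp _ _ _ (opoly (adj z) (expp F p - 1))) // opoly_poly.
apply: eq_bigr => k _; congr (_ *: _).
have JW0 : J 0 W by apply: JD; [apply: JW | apply: JO => //; apply: JW].
elim: (nat_of_ord k) => //= m ->; set u := iter m _ _.
have Ju : J 0 u by rewrite /u; elim: m {u} => //= m IHm; apply: JB => //; rewrite /w; do 2!apply/JO => //.
by rewrite opolyD -polyCN opolyC scaleN1r wE.
Qed.

End GradedNilpotent.

(** * Dynkin's form of the Baker-Campbell-Hausdorff series in a filtered algebra *)

Section DynkinSeries.

Variables (F : fieldType) (p : nat).
Hypothesis p_gt1 : (1 < p)%N.
Hypothesis natF_neq0 : forall k, (0 < k < p)%N -> k%:R != 0 :> F.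

Variables (A : algType F) (J : nat -> A -> Prop).
Hypothesis JD : forall k x y, J k x -> J k y -> J k (x + y).
Hypothesis JZ : forall k c x, J k x -> J k (c *: x).
Hypothesis J_1 : J 0 1.
Hypothesis JM : forall i j x y, J i x -> J j y -> J (i + j) (x * y).
Hypothesis JW : forall k x, J k.+1 x -> J k x.
Hypothesis Jp : forall x, J p x -> x = 0.

Variable delta : {linear A -> A}.
Hypothesis deltaM : forall x y, delta (x * y) = delta x * y + x * delta y.
Hypothesis Jdelta : forall k x, J k x -> J k (delta x).
Hypothesis delta_inj : forall x, J 1 x -> delta x = 0 -> x = 0.

(** The analogue of [lie_word] for commutators in an associative algebra. *)
Fixpoint adj_word (w : seq A) : A :=
  match w with
  | [::] => 0
  | [:: x] => x
  | x :: w' => adj x (adj_word w')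
  end.

Lemma adj_word_cons x w : w != [::] -> adj_word (x :: w) = adj x (adj_word w).
Proof. by case: w. Qed.

Lemma adj_word_nseq r x w :
  w != [::] -> adj_word (nseq r x ++ w) = iter r (adj x) (adj_word w).
Proof.
move=> w0; elim: r => // r IHr; rewrite -[nseq _ _ ++ _]/(x :: (nseq r x ++ w)).
by rewrite adj_word_cons ?IHr //; case: r {IHr} => //=.
Qed.

Definition block_word T (x y : T) (rs : seq (nat * nat)) : seq T :=
  flatten [seq nseq t.1 x ++ nseq t.2 y | t <- rs].

Lemma size_block_word T (x y : T) rs :
  size (block_word x y rs) = dynkin_degree rs.
Proof.
rewrite /dynkin_degree; elim: rs => [|t rs IHrs]; first by rewrite big_nil.
by rewrite /block_word /= size_cat -/(block_word x y rs) IHrs size_cat !size_nseq big_cons.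
Qed.

Lemma J_adj_word w : (forall u, u \in w -> J 1 u) -> J (size w) (adj_word w).
Proof.
elim: w => [|x w IHw] Jw; first by rewrite /= -(scale0r 1); apply: JZ.
have Jx : J 1 x by apply: Jw; rewrite mem_head.
have [->//|w0] := eqVneq w [::]; rewrite adj_word_cons //; apply: J_adj => //.
by apply: IHw => u uw; apply: Jw; rewrite inE uw orbT.
Qed.

(** A derivation adds weights, and each letter has weight 1. *)
Lemma delta_adj_word w :
  (forall u, u \in w -> delta u = u) ->
  delta (adj_word w) = (size w)%:R *: adj_word w.
Proof.
elim: w => [|x w IHw] dw; first by rewrite /= linear0 scaler0.
have dx : delta x = x by apply: dw; rewrite mem_head.
have [->//|w0] := eqVneq w [::]; first by rewrite scale1r.
rewrite adj_word_cons // /adj linearB !deltaM dx IHw => [|u uw]; last first.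
  by apply: dw; rewrite inE uw orbT.
rewrite -scalerAl -scalerAr -[size (x :: w)]add1n natrD scalerDl scale1r.
by rewrite scalerBr [in X in _ - X]addrC opprD addrACA.
Qed.

Variables x y : A.
Hypothesis Jx : J 1 x.
Hypothesis Jy : J 1 y.
Hypothesis dx : delta x = x.
Hypothesis dy : delta y = y.

Lemma mem_block_word rs u : u \in block_word x y rs -> u = x \/ u = y.
Proof.
move=> /flattenP[s /mapP[t _ ->]]; rewrite mem_cat !mem_nseq.
by case/orP => /andP[_ /eqP]; [left | right].
Qed.

Let word rs := adj_word (block_word x y rs).
Let nonzero_blocks (rs : seq (nat * nat)) := all (fun t => 0 < t.1 + t.2)%N rs.

Definition block_weight (rs : seq (nat * nat)) : F :=
  \prod_(t <- rs) ((t.1)`! * (t.2)`!)%N%:R^-1.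

Let expAd v := opoly (adj x) (expp F p) (opoly (adj y) (expp F p) v).

Lemma expAdE v :
  expAd v = \sum_(t : 'I_p * 'I_p)
     ((t.1)`! * (t.2)`!)%N%:R^-1 *: iter t.1 (adj x) (iter t.2 (adj y) v).
Proof.
rewrite /expAd !opoly_poly -(pair_bigA _ (fun r s : 'I_p =>
  (r`! * s`!)%N%:R^-1 *: iter r (adj x) (iter s (adj y) v))) /=.
apply: eq_bigr => r _; rewrite linear_sum scaler_sumr; apply: eq_bigr => s _.
by rewrite linearZ scalerA natrM invfM.
Qed.

Lemma sum_tuple_cons (I : finType) k (P : pred (seq I)) (G : seq I -> A) :
  \sum_(rs : k.+1.-tuple I | P rs) G rs =
    \sum_(t : I) \sum_(rs : k.-tuple I | P (t :: rs)) G (t :: rs).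
Proof.
rewrite pair_big_dep /= (reindex (fun u : I * k.-tuple I => cons_tuple u.1 u.2)) //.
exists (fun rs => (thead rs, [tuple of behead rs])) => [[t rs] _|rs _] /=.
  by rewrite theadE; congr (_, _); apply: val_inj.
by rewrite [RHS]tuple_eta; apply: val_inj.
Qed.

Let pairs (rs : seq ('I_p * 'I_p)) : seq (nat * nat) :=
  [seq (val t.1, val t.2) | t <- rs].

Lemma word_cons t rs :
  rs != [::] -> nonzero_blocks rs ->
  word (t :: rs) = iter t.1 (adj x) (iter t.2 (adj y) (word rs)).
Proof.
move=> rs0 nz; rewrite /word /block_word /= -catA -/(block_word x y rs).
have w0 : block_word x y rs != [::].
  rewrite -size_eq0 size_block_word /dynkin_degree.
  by case: rs rs0 nz => //= u rs _ /andP[u0 _]; rewrite big_cons -lt0n addn_gt0 u0.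
by rewrite !adj_word_nseq //; case: (t.2).
Qed.

(** Right-nested words ending in two equal letters vanish because [adj z z] is 0. A single block
    thus survives only with exactly one trailing [y], or as the letter [x] alone. *)
Lemma word1 r s :
  word [:: (r, s)] =
    if s == 1%N then iter r (adj x) y else if (s == 0%N) && (r == 1%N) then x else 0.
Proof.
have adjxx z : adj z z = 0 by rewrite /adj subrr.
have tail0 m z : adj_word (nseq m.+2 z) = 0.
  have -> : nseq m.+2 z = nseq m z ++ [:: z; z] by elim: m => //= m ->.
  by rewrite adj_word_nseq //= adjxx linear0.
rewrite /word /block_word /= cats0; case: s => [|[|s]] /=.
- by rewrite cats0; case: r => [|[|r]] //; apply: tail0.
- by rewrite adj_word_nseq.
- by rewrite adj_word_nseq // -[_ :: _]/(nseq s.+2 y) tail0 linear0.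
Qed.

Let W := x + opoly (adj x) (expp F p) y.

(** Induction on the number of blocks: the last block contributes [W] by [word1], and each block put
    in front applies one term of e^(ad x) e^(ad y) other than the identity term. *)
Lemma sum_blocks k :
  \sum_(rs : k.+1.-tuple ('I_p * 'I_p) | nonzero_blocks (pairs rs))
     block_weight (pairs rs) *: word (pairs rs)
  = iter k (fun v => expAd v - v) W.
Proof.
pose nz (rs : seq ('I_p * 'I_p)) := nonzero_blocks (pairs rs).
pose G (rs : seq ('I_p * 'I_p)) := block_weight (pairs rs) *: word (pairs rs).
have p0 : (0 < p)%N := ltnW p_gt1.
elim: k => [|k IHk].
  rewrite (sum_tuple_cons _ nz G).
  have sum0 (P : pred (0.-tuple ('I_p * 'I_p))) (g : 0.-tuple ('I_p * 'I_p) -> A) :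
      P [tuple] -> \sum_(rs | P rs) g rs = g [tuple].
    by move=> P0; rewrite (big_pred1 [tuple]) // => rs; rewrite [rs]tuple0 [LHS]P0 /= eqxx.
  transitivity (\sum_(t : 'I_p * 'I_p) if (0 < t.1 + t.2)%N then
      ((t.1)`! * (t.2)`!)%N%:R^-1 *: word [:: (val t.1, val t.2)] else 0).
    apply: eq_bigr => t _; case: ifP => t0.
      rewrite sum0 /nz /= ?t0 // /G /block_weight /= big_seq1 //.
    by rewrite big_pred0 // => rs; rewrite /nz /= t0.
  rewrite -(pair_bigA _ (fun r s : 'I_p => if (0 < r + s)%N then
     (r`! * s`!)%N%:R^-1 *: word [:: (val r, val s)] else 0)) /=.
  have bigS r : \sum_(s < p) (if (0 < r + s)%N then
     (r`! * s`!)%N%:R^-1 *: word [:: (r, val s)] else 0) =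
     (r`!)%:R^-1 *: iter r (adj x) y + (if r == 1%N then x else 0).
    rewrite (bigD1 (Ordinal p_gt1)) //= addn1 /= word1 /= muln1; congr (_ + _).
    rewrite (bigD1 (Ordinal p0)) //= big1 ?addr0 => [|s /andP[s1 s0]].
      rewrite word1 /= addn0 fact0 muln1; case: eqP => [->|_] /=.
        by rewrite (_ : 1`! = 1%N) // invr1 scale1r.
      by rewrite scaler0 if_same.
    move: s1 s0; rewrite word1 -!val_eqE /= => /negPf-> /negPf->.
    by rewrite scaler0 if_same.
  rewrite (eq_bigr _ (fun r _ => bigS (val r))) big_split /= addrC /W opoly_poly.
  congr (_ + _); rewrite (bigD1 (Ordinal p_gt1)) //= big1 ?addr0 // => i.
  by rewrite -val_eqE /= => /negPf->.
rewrite (sum_tuple_cons _ nz G) iterS -IHk; set v := \sum_(rs | nonzero_blocks _) _.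
transitivity (\sum_(t : 'I_p * 'I_p) if (0 < t.1 + t.2)%N then
      ((t.1)`! * (t.2)`!)%N%:R^-1 *: iter t.1 (adj x) (iter t.2 (adj y) v) else 0).
  apply: eq_bigr => t _; case: ifP => t0; last first.
    by rewrite big_pred0 // => rs; rewrite /nz /= t0.
  rewrite /v (linear_sum (iter t.2 (adj y))) (linear_sum (iter t.1 (adj x))).
  rewrite scaler_sumr; apply: eq_big => [rs|rs nzrs].
    by rewrite /nz /= t0.
  rewrite /G /block_weight /= big_cons word_cons /=; first last.
  - by move: nzrs; rewrite /nz /= t0.
  - by case: rs {nzrs} => -[].
  rewrite [iter t.2 _ (_ *: _)]linearZ [iter t.1 _ (_ *: _)]linearZ scalerA.
  by [].
(* Excluding the block (0, 0) subtracts the identity from [expAd]. *)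
rewrite expAdE (bigD1 (Ordinal p0, Ordinal p0)) //= [in RHS](bigD1 (Ordinal p0, Ordinal p0)) //=.
rewrite add0r muln1 invr1 scale1r addrAC subrr add0r; apply: eq_bigr => -[r s] /=.
by rewrite xpair_eqE -!val_eqE /=; case: ifP => //; case: r s => -[|r] ? [[|s] ?].
Qed.

Definition dynkin_coefF (rs : seq (nat * nat)) : F :=
  (-1) ^+ (size rs).-1 /
  ((size rs)%:R * (dynkin_degree rs)%:R
     * \prod_(t <- rs) ((t.1)`! * (t.2)`!)%N%:R).

Lemma dynkin_degree_gt0 rs :
  rs != [::] -> nonzero_blocks rs -> (0 < dynkin_degree rs)%N.
Proof.
by case: rs => //= t rs _ /andP[t0 _]; rewrite /dynkin_degree big_cons addn_gt0 t0.
Qed.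

Lemma J_word rs : J (dynkin_degree rs) (word rs).
Proof.
rewrite -(size_block_word x y); apply: J_adj_word => u /mem_block_word.
by case=> ->.
Qed.

Lemma delta_word rs : delta (word rs) = (dynkin_degree rs)%:R *: word rs.
Proof.
rewrite -(size_block_word x y); apply: delta_adj_word => u /mem_block_word.
by case=> ->.
Qed.

(** The product of the exponentials is e^z for some [z] in [J 1]. This [z] and the Dynkin sum have
    the same image under [delta], which is injective on [J 1]. *)
Lemma texp_dynkin :
  texp p (\sum_(1 <= k < p)
     \sum_(rs : k.-tuple ('I_p * 'I_p) | dynkin_index p (nat_pairs rs))
        dynkin_coefF (nat_pairs rs) *: adj_word (block_word x y (nat_pairs rs)))
  = texp p x * texp p y.
Proof.
have [z Jz zE] : exists2 z, J 1 z & texp p z = texp p x * texp p y.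
  apply: (texp_surj p_gt1 natF_neq0 JD JZ J_1 JM JW Jp).
  have -> : texp p x * texp p y - 1 = (texp p x - 1) * texp p y + (texp p y - 1).
    by rewrite mulrBl mul1r addrA subrK.
  by apply: JD; [rewrite -[1%N]addn0; apply: JM|]; do ?apply: texp1_J => //; apply: J_horner.
rewrite -zE; congr (texp p _); apply/eqP; rewrite eq_sym -subr_eq0; apply/eqP.
have nonnil k (rs : k.+1.-tuple ('I_p * 'I_p)) : nat_pairs rs != [::].
  by case: rs => -[].
have Jsum (I : Type) (r : seq I) (P : pred I) (G : I -> A) :
    (forall i, P i -> J 1 (G i)) -> J 1 (\sum_(i <- r | P i) G i).
  move=> JG; elim/big_rec: _ => [|i u Pi Ju]; first by rewrite -(scale0r x); apply: JZ.
  by apply: JD => //; apply: JG.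
rewrite big_add1 big_mkord; apply: delta_inj.
  apply: JB => //; apply: (Jsum) => k _; apply: (Jsum) => rs /andP[nz _]; apply: JZ.
  by apply: (J_leq JW _ (J_word _)); rewrite dynkin_degree_gt0.
rewrite linearB /=; apply/eqP; rewrite subr_eq0; apply/eqP.
rewrite (delta_log_texpM p_gt1 natF_neq0 JD JZ J_1 JM JW Jp deltaM Jdelta Jx Jy Jz dx dy zE).
rewrite linear_sum; apply: eq_bigr => k _; rewrite -sum_blocks scaler_sumr linear_sum.
(* Words of degree at least p vanish, so the degree bound in [dynkin_index] discards only zero
   terms. *)
rewrite (bigID (fun rs : k.+1.-tuple _ => dynkin_degree (nat_pairs rs) < p)%N) /=.
rewrite [X in _ + X]big1 ?addr0 => [|rs /andP[_]]; last first.
  rewrite -leqNgt => pdeg; have := J_big0 JW Jp pdeg (J_word _); rewrite /word => ->.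
  by rewrite scaler0 linear0.
apply: eq_bigr => rs /andP[nz degp]; rewrite [RHS]linearZ /=.
(* The degree by which [delta] multiplies a word cancels the degree in the denominator of
   [dynkin_coefF]. *)
have := delta_word (nat_pairs rs); rewrite /word => ->; rewrite !scalerA.
congr (_ *: _); rewrite /dynkin_coefF size_map size_tuple /=.
have deg0 : (dynkin_degree (nat_pairs rs))%:R != 0 :> F.
  by rewrite natF_neq0 // degp dynkin_degree_gt0.
rewrite /block_weight -/(nat_pairs rs) prodfV !invfM -!mulrA; do 2!congr (_ * _).
by rewrite mulrC mulfK.
Qed.

End DynkinSeries.

(* Matrices over F[t], seen as an algebra over F rather than over F[t]. *)
Definition polymx (F : fieldType) (n : nat) : Type := 'M[{poly F}]_n.+1.

(** * Homogenization: matrices over F[t] graded by the degree in t, and their values at t = 1 *)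

Section PolynomialMatrices.

Variables (F : fieldType) (n : nat).
Local Notation P := (polymx F n).

HB.instance Definition _ := GRing.NzRing.on P.

Definition polymx_scale (c : F) (M : P) : P := (c%:P : {poly F}) *: (M : 'M_n.+1).

Fact polymx_scaleA a b M : polymx_scale a (polymx_scale b M) = polymx_scale (a * b) M.
Proof. by rewrite /polymx_scale scalerA polyCM. Qed.
Fact polymx_scale1 : left_id 1 polymx_scale.
Proof. by move=> M; rewrite /polymx_scale scale1r. Qed.
Fact polymx_scaleDr : right_distributive polymx_scale +%R.
Proof. by move=> a M N; rewrite /polymx_scale scalerDr. Qed.
Fact polymx_scaleDl M : {morph polymx_scale^~ M : a b / a + b}.
Proof. by move=> a b; rewrite /polymx_scale polyCD scalerDl. Qed.
HB.instance Definition _ := GRing.Zmodule_isLmodule.Build F P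
  polymx_scaleA polymx_scale1 polymx_scaleDr polymx_scaleDl.

Fact polymx_scaleAl (a : F) (M N : P) : a *: (M * N) = a *: M * N.
Proof. exact: (scalerAl (a%:P : {poly F}) (M : 'M_n.+1)). Qed.
HB.instance Definition _ := GRing.Lmodule_isLalgebra.Build F P polymx_scaleAl.

Fact polymx_scaleAr (a : F) (M N : P) : a *: (M * N) = M * (a *: N).
Proof. exact: (scalerAr (a%:P : {poly F}) (M : 'M_n.+1)). Qed.
HB.instance Definition _ := GRing.Lalgebra_isAlgebra.Build F P polymx_scaleAr.

Lemma polymxZE (c : F) (M : P) i j : (c *: M) i j = c *: M i j.
Proof. by rewrite /GRing.scale /= /polymx_scale mxE mul_polyC. Qed.

Lemma polymxDE (M N : P) i j : (M + N) i j = M i j + N i j.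
Proof. exact: mxE. Qed.

Lemma polymxME (M N : P) i j : (M * N) i j = \sum_k M i k * N k j.
Proof. exact: mxE. Qed.

(* The derivation t d/dt. *)
Definition euler (M : P) : P := map_mx (fun q : {poly F} => 'X * q^`()) (M : 'M_n.+1).

Lemma eulerE (M : P) i j : euler M i j = 'X * (M i j)^`().
Proof. exact: mxE. Qed.

Fact euler_is_linear : linear euler.
Proof.
move=> a M N; apply/matrixP => i j.
by rewrite polymxDE polymxZE !eulerE polymxDE polymxZE derivD derivZ mulrDr scalerAr.
Qed.
HB.instance Definition _ := GRing.isLinear.Build F P P _ euler euler_is_linear.

Lemma eulerM (M N : P) : euler (M * N) = euler M * N + M * euler N.
Proof.
apply/matrixP => i j; rewrite polymxDE eulerE !polymxME raddf_sum mulr_sumr -big_split.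
by apply: eq_bigr => k _; rewrite !eulerE /= derivM; ring.
Qed.

Definition polymx_eval1 (M : P) : 'M[F]_n.+1 := map_mx (horner_eval 1) (M : 'M_n.+1).

Lemma polymx_eval1E (M : P) i j : polymx_eval1 M i j = (M i j).[1].
Proof. exact: mxE. Qed.

Fact polymx_eval1_is_linear : linear polymx_eval1.
Proof.
move=> a M N; apply/matrixP => i j.
rewrite [RHS]mxE [X in _ = X + _]mxE !polymx_eval1E.
by rewrite polymxDE polymxZE hornerD hornerZ.
Qed.
HB.instance Definition _ :=
  GRing.isLinear.Build F P 'M[F]_n.+1 _ polymx_eval1 polymx_eval1_is_linear.

Fact polymx_eval1_is_monoid_morphism : monoid_morphism polymx_eval1.
Proof. by split=> [|M N]; rewrite /polymx_eval1 ?(map_mx1 (horner_eval 1)) ?map_mxM. Qed.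
HB.instance Definition _ := GRing.isMonoidMorphism.Build P 'M[F]_n.+1 polymx_eval1
  polymx_eval1_is_monoid_morphism.

(** The substitution of tx for [x], which makes [x] homogeneous of degree 1 for [euler]. *)
Definition polymx_lift (x : 'M[F]_n.+1) : P := \matrix_(i, j) (x i j *: 'X).

Lemma polymx_liftK x : polymx_eval1 (polymx_lift x) = x.
Proof. by apply/matrixP => i j; rewrite polymx_eval1E mxE hornerZ hornerX mulr1. Qed.

Lemma euler_lift x : euler (polymx_lift x) = polymx_lift x.
Proof. by apply/matrixP => i j; rewrite eulerE !mxE derivZ derivX -scalerAr mulr1. Qed.

Lemma texp_eval1 p (z : P) : polymx_eval1 (texp p z) = texp p (polymx_eval1 z).
Proof.
rewrite /texp; elim/poly_ind: (expp F p) => [|q c IHq]; first by rewrite !rmorph0.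
by rewrite !(rmorphD, rmorphM) /= IHq !horner_algX !horner_algC linearZ rmorph1.
Qed.

Lemma adj_word_eval1 (w : seq P) :
  polymx_eval1 (adj_word w) = adj_word [seq polymx_eval1 u | u <- w].
Proof.
elim: w => [|u [|v w] IHw]; rewrite ?rmorph0 //.
by rewrite map_cons adj_word_cons // [RHS]adj_word_cons // -IHw /adj rmorphB !rmorphM.
Qed.

Variables (p : nat) (h : 'I_n.+1 -> nat).
Hypothesis p_gt1 : (1 < p)%N.
Hypothesis natF_neq0 : forall k, (0 < k < p)%N -> k%:R != 0 :> F.
Hypothesis h_lt : forall i, (h i < p)%N.

(* Bounding the degree by h j - h i < p makes graded_mx p trivial while keeping
   t d/dt injective on graded_mx 1, in spite of the characteristic. *)
Definition graded_mx k (M : P) : Prop :=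
  forall i j m, (M i j)`_m != 0 -> (k <= m)%N /\ (h i + m <= h j)%N.

Lemma gradedD k x y : graded_mx k x -> graded_mx k y -> graded_mx k (x + y).
Proof.
move=> gx gy i j m; rewrite polymxDE coefD.
have [->|x0 _] := eqVneq ((x i j)`_m) 0; first by rewrite add0r => /gy.
exact: gx.
Qed.

Lemma gradedZ k c x : graded_mx k x -> graded_mx k (c *: x).
Proof.
by move=> gx i j m; rewrite polymxZE coefZ mulf_eq0 negb_or => /andP[_ /gx].
Qed.

Lemma graded1 : graded_mx 0 1.
Proof.
move=> i j m; rewrite mxE; case: (i =P j) => [->|_]; last by rewrite coef0 eqxx.
by rewrite coef1; case: m => [|m]; rewrite ?eqxx ?addn0.
Qed.

Lemma gradedM k l x y : graded_mx k x -> graded_mx l y -> graded_mx (k + l) (x * y).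
Proof.
move=> gx gy i j m; rewrite polymxME coef_sum => /eqP/eqP m0.
have [u] : exists u, (x i u * y u j)`_m != 0.
  apply/existsP; apply: contraNT m0 => /existsPn u0; rewrite big1 // => u _.
  by apply/eqP; rewrite -[_ == _]negbK u0.
rewrite coefM => {}m0.
have [s] : exists s : 'I_m.+1, (x i u)`_s * (y u j)`_(m - s) != 0.
  apply/existsP; apply: contraNT m0 => /existsPn u0; rewrite big1 // => s _.
  by apply/eqP; rewrite -[_ == _]negbK u0.
rewrite mulf_eq0 negb_or => /andP[/gx[ks his] /gy[ls hsj]].
have sm : (s <= m)%N by rewrite -ltnS.
rewrite -(subnKC sm); split; first exact: leq_add.
by rewrite addnA; apply: leq_trans hsj; rewrite leq_add2r.
Qed.

Lemma gradedW k x : graded_mx k.+1 x -> graded_mx k x.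
Proof. by move=> gx i j m /gx[/ltnW]. Qed.

Lemma graded_p x : graded_mx p x -> x = 0.
Proof.
move=> gx; apply/matrixP => i j; apply/polyP => m; rewrite [in RHS]mxE coef0.
apply/eqP; apply: contraT => /gx[pm hm].
by have := leq_trans pm (leq_trans (leq_addl _ _) hm); rewrite leqNgt h_lt.
Qed.

Lemma coef_euler x i j m : (euler x i j)`_m = (x i j)`_m *+ m.
Proof. by rewrite eulerE coefXM; case: m => [|m] //=; rewrite coef_deriv. Qed.

Lemma graded_euler k x : graded_mx k x -> graded_mx k (euler x).
Proof.
move=> gx i j m; rewrite coef_euler => m0; apply: gx.
by apply: contraNneq m0 => ->; rewrite mul0rn.
Qed.

Lemma euler_inj x : graded_mx 1 x -> euler x = 0 -> x = 0.
Proof.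
move=> gx dx; apply/matrixP => i j; apply/polyP => m; rewrite [in RHS]mxE coef0.
apply/eqP; apply: contraT => x0; have [m0 hm] := gx _ _ _ x0.
have mp : (m < p)%N by apply: leq_ltn_trans (h_lt j); apply: leq_trans hm; apply: leq_addl.
have := coef_euler x i j m; rewrite dx mxE coef0 -mulr_natr => /esym/eqP.
by rewrite mulf_eq0 (negPf x0) (negPf (natF_neq0 _)) // m0.
Qed.

(** What remains of [graded_mx] at t = 1; it supplies the filtration [J] for matrices over F
    itself. *)
Definition filtered_mx k (x : 'M[F]_n.+1) : Prop :=
  forall i j, x i j != 0 -> (h i + k <= h j)%N.

Lemma filteredD k x y : filtered_mx k x -> filtered_mx k y -> filtered_mx k (x + y).
Proof.
move=> gx gy i j; rewrite mxE.
have [->|x0 _] := eqVneq (x i j) 0; first by rewrite add0r => /gy.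
exact: gx.
Qed.

Lemma filteredZ k c x : filtered_mx k x -> filtered_mx k (c *: x).
Proof. by move=> gx i j; rewrite mxE mulf_eq0 negb_or => /andP[_ /gx]. Qed.

Lemma filtered1 : filtered_mx 0 1.
Proof. by move=> i j; rewrite mxE; case: (i =P j) => [->|_]; rewrite ?eqxx ?addn0. Qed.

Lemma filteredM k l x y :
  filtered_mx k x -> filtered_mx l y -> filtered_mx (k + l) (x * y).
Proof.
move=> gx gy i j; rewrite mxE => m0.
have [u] : exists u, x i u * y u j != 0.
  apply/existsP; apply: contraNT m0 => /existsPn u0; rewrite big1 // => u _.
  by apply/eqP; rewrite -[_ == _]negbK u0.
rewrite mulf_eq0 negb_or => /andP[/gx xu /gy].
by rewrite addnA; apply: leq_trans; rewrite leq_add2r.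
Qed.

Lemma filteredW k x : filtered_mx k.+1 x -> filtered_mx k x.
Proof. by move=> gx i j /gx; rewrite addnS => /ltnW. Qed.

Lemma filtered_p x : filtered_mx p x -> x = 0.
Proof.
move=> gx; apply/matrixP => i j; rewrite [in RHS]mxE.
apply/eqP; apply: contraT => /gx hm.
by have := leq_trans (leq_addl _ _) hm; rewrite leqNgt h_lt.
Qed.

Lemma graded_lift x : filtered_mx 1 x -> graded_mx 1 (polymx_lift x).
Proof.
move=> fx i j m; rewrite mxE coefZ coefX mulf_eq0 negb_or => /andP[/fx xij].
by have [->|] := eqVneq m 1%N; rewrite ?eqxx.
Qed.

Lemma texp_mx_inj (x y : 'M[F]_n.+1) :
  filtered_mx 1 x -> filtered_mx 1 y -> texp p x = texp p y -> x = y.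
Proof.
exact: (texp_inj p_gt1 natF_neq0 filteredD filteredZ filtered1 filteredM filteredW filtered_p).
Qed.

(** The Euler derivation needs the variable t, so [texp_dynkin] is applied to tx and ty over F[t]
    and the result is evaluated at t = 1. *)
Lemma texp_mx_dynkin (x y : 'M[F]_n.+1) :
  filtered_mx 1 x -> filtered_mx 1 y ->
  texp p (\sum_(1 <= k < p)
     \sum_(rs : k.-tuple ('I_p * 'I_p) | dynkin_index p (nat_pairs rs))
        dynkin_coefF F (nat_pairs rs) *: adj_word (block_word x y (nat_pairs rs)))
  = texp p x * texp p y.
Proof.
move=> fx fy.
have := texp_dynkin p_gt1 natF_neq0 gradedD gradedZ graded1 gradedM gradedW graded_p
  eulerM graded_euler euler_inj (graded_lift fx) (graded_lift fy)
  (euler_lift x) (euler_lift y).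
move=> /(congr1 polymx_eval1); rewrite rmorphM /= !texp_eval1 !polymx_liftK => <-.
congr (texp p _); rewrite linear_sum; apply: eq_bigr => k _.
rewrite linear_sum; apply: eq_bigr => rs _; rewrite linearZ /= adj_word_eval1.
congr (_ *: adj_word _); rewrite /block_word map_flatten -map_comp.
by congr flatten; apply: eq_map => t /=; rewrite map_cat !map_nseq !polymx_liftK.
Qed.

End PolynomialMatrices.

(** * Rational Dynkin coefficients acting on the pattern Lie algebra over F *)

Section PatternGroup.

Variables (n : nat) (prec : strict_order n) (p f : nat) (F : finFieldType).
Hypothesis p_prime : prime p.
Hypothesis cardF : #|F| = (p ^ f)%N.
Local Notation L := (pattern_lie prec F : finLieRingType).

Lemma pcharF : p \in [pchar F].
Proof. exact: card_finPcharP cardF p_prime. Qed.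

Lemma natF_neq0 k : (0 < k < p)%N -> k%:R != 0 :> F.
Proof.
move=> /andP[k0 kp]; rewrite -(dvdn_pcharf pcharF); apply/negP => /(dvdn_leq k0).
by rewrite leqNgt kp.
Qed.

(** The additive group of [L] is a subgroup of the matrix group, so its order divides a power of
    p. *)
Lemma coprime_pattern (d : nat) : d%:R != 0 :> F -> coprime d #|L|.
Proof.
move=> d0; pose G := [set A : 'M[F]_n | A \in pattern_mx prec (R := F)].
have gG : group_set G.
  apply/group_setP; split=> [|A B]; rewrite !inE; first exact: rpred0.
  exact: rpredD.
have cL : #|L| = #|Group gG| by rewrite card_sub cardsE.
have dL := cardSg (subsetT (Group gG)).
rewrite -cL cardsT card_mx cardF -expnM in dL.
apply: (coprime_dvdr dL); rewrite coprimeXr // coprime_sym prime_coprime //.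
by rewrite (dvdn_pcharf pcharF).
Qed.

(** The numerator is a sign, so the fraction is already reduced and [rat_scaleP] applies with
    denominator [N]; the factor [N] is then cancelled in F. *)
Lemma val_rat_scale (s N : nat) (u : L) : N%:R != 0 :> F ->
  val (rat_scale ((-1) ^+ s / N%:R) u) = ((-1) ^+ s / N%:R) *: val u.
Proof.
move=> N0; set c : rat := _ / _.
have N0' : N%:Z != 0 by rewrite eqz_nat; apply: contraNneq N0 => ->.
have [dN nN] : denq c = N%:Z /\ numq c = (-1) ^+ s.
  have cE : c = ((-1) ^+ s : int)%:~R / N%:Z%:~R by rewrite rmorphXn /= rmorphN1.
  have co : coprime `|(-1) ^+ s : int|%N `|N%:Z|%N by rewrite abszX exp1n coprime1n.
  rewrite cE coprimeq_num // coprimeq_den // (negPf N0') gtr0_sg ?mul1r //.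
  by rewrite lt0r N0'.
have := @rat_scaleP L c u; rewrite dN nN /= => /(_ (coprime_pattern N0)).
move=> /(congr1 (@pattern_val n prec F)); rewrite !raddfMz /= -pmulrn -scaler_nat => e.
apply: (scalerI N0); rewrite e scalerA mulrCA divff // mulr1.
by rewrite -scaler_int rmorphXn /= rmorphN1.
Qed.

Lemma dynkin_coef_natE (rs : seq (nat * nat)) :
  let N := (size rs * dynkin_degree rs * \prod_(t <- rs) ((t.1)`! * (t.2)`!))%N in
  dynkin_coef rs = (-1) ^+ (size rs).-1 / N%:R.
Proof. by rewrite /dynkin_coef !natrM natr_prod. Qed.

Lemma dynkin_coefF_natE (rs : seq (nat * nat)) :
  let N := (size rs * dynkin_degree rs * \prod_(t <- rs) ((t.1)`! * (t.2)`!))%N in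
  dynkin_coefF F rs = (-1) ^+ (size rs).-1 / N%:R.
Proof. by rewrite /dynkin_coefF !natrM natr_prod. Qed.

(** The number of blocks and the degree lie strictly between 0 and p, and the factorials are of
    numbers below p, so the denominator is invertible in F. *)
Lemma val_dynkin_term k (rs : k.-tuple ('I_p * 'I_p)) (u : L) :
  (0 < k < p)%N -> dynkin_index p (nat_pairs rs) ->
  val (rat_scale (dynkin_coef (nat_pairs rs)) u) =
    dynkin_coefF F (nat_pairs rs) *: val u.
Proof.
move=> kp /andP[nz degp]; rewrite dynkin_coef_natE dynkin_coefF_natE val_rat_scale //.
have /andP[k0 _] := kp; rewrite !natrM; apply: mulf_neq0; first apply: mulf_neq0.
- by rewrite natF_neq0 // size_map size_tuple.
- rewrite natF_neq0 // degp andbT dynkin_degree_gt0 // -size_eq0 size_map size_tuple.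
  by rewrite -lt0n.
rewrite natr_prod prodf_seq_neq0; apply/allP => t /mapP[[r s] _ ->] /=.
by rewrite natrM mulf_neq0 // (factF_neq0 natF_neq0).
Qed.

End PatternGroup.

(** * Heights of elements in the order *)

Section Height.

Variables (n : nat) (prec : strict_order n).

Let chain_to (j : 'I_n) (r : nat) : bool :=
  [exists i, [exists s : r.-tuple 'I_n, path prec i s && (last i s == j)]].

Let chain_to0 j : exists r, chain_to j r.
Proof. by exists 0%N; apply/existsP; exists j; apply/existsP; exists [tuple] => /=. Qed.

Let chain_to_le j r : chain_to j r -> (r <= prec_length prec)%N.
Proof.
move=> /existsP[i /existsP[s /andP[ps _]]].
exact: (@prec_length_max _ _ r (cons_tuple i s)).
Qed.

(** The length of a longest chain ending at [j]; it will serve as the grading function [h] of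
    [filtered_mx] and [graded_mx]. *)
Definition height j : nat := ex_maxn (chain_to0 j) (@chain_to_le j).

Lemma height_le j : (height j <= prec_length prec)%N.
Proof. by rewrite /height; case: ex_maxnP => r /chain_to_le. Qed.

Lemma height_lt i j : prec i j -> (height i < height j)%N.
Proof.
move=> ij; rewrite /height; case: ex_maxnP => r /existsP[k /existsP[s /andP[ps ls]]] _.
case: ex_maxnP => m _; apply; apply/existsP; exists k; apply/existsP.
by exists (rcons_tuple s j); rewrite rcons_path ps (eqP ls) ij last_rcons /=.
Qed.

End Height.

(** * The truncated exponential on the pattern Lie algebra *)

Section PatternExp.

Variables (n : nat) (prec : strict_order n.+1) (p f : nat) (F : finFieldType).
Hypothesis p_prime : prime p.
Hypothesis cardF : #|F| = (p ^ f)%N.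
Hypothesis length_lt : (prec_length prec < p)%N.
Local Notation L := (pattern_lie prec F : finLieRingType).

Lemma pattern_filtered (x : L) : filtered_mx (height prec) 1 (val x).
Proof.
move=> i j xij; rewrite addn1 height_lt //; apply: contraNT xij => nij.
by rewrite (pattern_mx0P _ _ (pattern_valP x)).
Qed.

Lemma val_lie_word (w : seq L) : val (lie_word w) = adj_word [seq val u | u <- w].
Proof. by elim: w => // u [|v w] //= ->. Qed.

Lemma pattern_horner (x : 'M[F]_n.+1) q :
  x \in pattern_mx prec (R := F) -> x * horner_alg x q \in pattern_mx prec (R := F).
Proof.
move=> Px; elim/poly_ind: q => [|q c IHq]; first by rewrite rmorph0 mulr0 rpred0.
rewrite rmorphD rmorphM /= horner_algX horner_algC mulrDr mulrA.
apply: rpredD; first exact: pattern_mxM.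
rewrite -scalerAr mulr1; apply/pattern_mx0P => i j nij.
by rewrite mxE (pattern_mx0P _ _ Px) ?mulr0.
Qed.

Fact pattern_exp_proof (x : L) : texp p (val x) - 1 \in pattern_mx prec (R := F).
Proof.
rewrite -(rmorph1 (horner_alg (val x))) -rmorphB -phip_expp ?prime_gt1 //.
rewrite rmorphM /= horner_algX pattern_horner //; exact: pattern_valP.
Qed.

Definition pattern_exp (x : L) : L := PatternLie (pattern_exp_proof x).

(** Injectivity comes from the truncated logarithm, through [texp_mx_inj], and surjectivity from
    finiteness. *)
Lemma pattern_exp_bij : bijective pattern_exp.
Proof.
apply: injF_bij => x y /(congr1 val) /= /addIr e; apply: val_inj.
apply: (texp_mx_inj (prime_gt1 p_prime) (natF_neq0 p_prime cardF)
  (h := height prec)) e => [i||]; try exact: pattern_filtered.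
exact: leq_ltn_trans (height_le _ _) length_lt.
Qed.

Lemma pattern_exp_bch (x y : L) :
  val (pattern_exp (bch p x y)) =
    val (pattern_exp x) + val (pattern_exp y) + val (pattern_exp x) *m val (pattern_exp y).
Proof.
have hp i : (height prec i < p)%N by apply: leq_ltn_trans (height_le _ _) length_lt.
have := texp_mx_dynkin (prime_gt1 p_prime) (natF_neq0 p_prime cardF) hp
  (@pattern_filtered x) (@pattern_filtered y).
set D := (X in texp p X) => texpD; have -> : val (pattern_exp (bch p x y)) = texp p D - 1.
  rewrite /=; congr (texp p _ - 1); rewrite /bch raddf_sum /D !big_nat.
  apply: eq_bigr => k kp; rewrite raddf_sum; apply: eq_bigr => rs rsP.
  rewrite -[LHS]/(val _) (val_dynkin_term p_prime cardF) // val_lie_word.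
  congr (_ *: adj_word _); rewrite /dynkin_word /block_word map_flatten -map_comp.
  by congr flatten; apply: eq_map => t /=; rewrite map_cat !map_nseq.
(* In terms of g = a - 1 and h = b - 1, the product ab becomes g + h + gh. *)
have circE (a b : 'M[F]_n.+1) : a * b - 1 = a - 1 + (b - 1) + (a - 1) * (b - 1).
  rewrite mulrBl mul1r mulrBr mulr1 -addrA [b - 1 + _]addrC subrK.
  by rewrite addrC addrA subrK.
by rewrite texpD circE.
Qed.

End PatternExp.

Lemma pattern_exp_exists (n : nat) (prec : strict_order n) (p f : nat)
    (F : finFieldType) :
  prime p -> #|F| = (p ^ f)%N -> (prec_length prec < p)%N ->
  exists2 h : pattern_lie prec F -> pattern_lie prec F, bijective h &
    forall x y, val (h (bch p x y)) = val (h x) + val (h y) + val (h x) *m val (h y).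
Proof.
(* Matrices of size 0 are all equal; those of positive size form a nonzero ring, as the exponential
   requires. *)
case: n prec => [|n] prec pp cF len.
  by exists id; [exists id | move=> x y; apply/matrixP => -[]].
exists (pattern_exp pp (F := F)); first exact: pattern_exp_bij cF len.
exact: pattern_exp_bch cF len.
Qed.

(** * A faithful additive character of F_p, and coordinates of F over F_p *)

Section FiniteFieldCharacters.

Variables (C : numClosedFieldType) (p : nat).
Hypothesis p_prime : prime p.

Lemma additive_char_exists :
  exists e : 'F_p -> C, [/\ e 0 = 1, {morph e : u v / u + v >-> u * v} & injective e].
Proof.
have p1 := prime_gt1 p_prime.
(* A root of 1 + X + ... + X^(p-1) is a p-th root of unity. *)
have [|z /rootP z0] := closed_rootP (\poly_(i < p) (1 : C)) _.
  by rewrite size_poly_eq ?oner_eq0 // neq_ltn p1 orbT.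
rewrite horner_poly (eq_bigr _ (fun _ _ => mul1r _)) in z0.
have zp : z ^+ p = 1 by apply/eqP; rewrite -subr_eq0 subrX1 z0 mulr0.
have [m zm mp] := prim_order_exists (prime_gt0 p_prime) zp.
have {}zm : p.-primitive_root z.
  (* The order divides p; it is not 1, since then a sum of p ones would vanish in C. *)
  have /primeP[_ /(_ m mp)/orP[/eqP m1|/eqP mE]] := p_prime; last by rewrite mE in zm.
  have z1 : z = 1 by have := prim_expr_order zm; rewrite m1 expr1.
  move: z0; rewrite z1 (eq_bigr (fun=> 1)) => [|i _]; last by rewrite expr1n.
  by rewrite sumr_const card_ord => /eqP; rewrite pnatr_eq0 eqn0Ngt prime_gt0.
exists (fun u : 'F_p => z ^+ u); split=> // [u v|u v /eqP].
  have modE a : (a %% (Zp_trunc (pdiv p)).+2 = a %% p)%N by rewrite Fp_cast.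
  by rewrite -exprD /= modE (prim_expr_mod zm).
have ltp (w : 'F_p) : (w < p)%N by apply: leq_trans (ltn_ord w) _; rewrite Fp_cast.
by rewrite (eq_prim_root_expr zm) !modn_small // => /eqP/val_inj.
Qed.

Lemma Fp_coordinates_exist (F : finFieldType) (f : nat) : #|F| = (p ^ f)%N ->
  exists2 c : F -> 'rV['F_p]_f, zmod_morphism c & bijective c.
Proof.
move=> cF; have pF := card_finPcharP cF p_prime.
have [c c_lin c_bij] := pprimeChar_vectAxiom pF.
have fE : logn p #|{: F}| = f by rewrite cF pfactorK.
exists (fun x : F => castmx (erefl, fE) (c x)).
  move=> x y; have cB : c (x - y) = c x - c y.
    by have := c_lin (-1) y x; rewrite !scaleN1r ![- _ + _]addrC.
  by rewrite cB; apply/rowP => k; rewrite !(castmxE, mxE).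
by apply: (bij_comp _ c_bij); exists (castmx (erefl, esym fE)); [exact: castmxK|exact: castmxKV].
Qed.

End FiniteFieldCharacters.

(** * Minimal and maximal elements around a given element *)

Section ExtremePairs.

Variables (n : nat) (prec : strict_order n).

(** An element of least height among those at or below [k] is minimal. *)
Lemma minimal_below (k : 'I_n) : exists2 i, prec_minimal prec i & (i == k) || prec i k.
Proof.
have k0 : (k == k) || prec k k by rewrite eqxx.
case: (@arg_minnP _ k (fun i => (i == k) || prec i k) (height prec) k0) => i ik imin; exists i => //.
apply/forallP => m; apply/negP => mi; suff /imin : (m == k) || prec m k.
  by rewrite /= leqNgt height_lt.
by case/orP: ik => [/eqP <-|ik]; rewrite ?mi ?(prec_trans mi ik) orbT.
Qed.

Lemma maximal_above (k : 'I_n) : exists2 j, prec_maximal prec j & (k == j) || prec k j.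
Proof.
have k0 : (k == k) || prec k k by rewrite eqxx.
case: (@arg_maxnP _ k (fun i => (k == i) || prec k i) (height prec) k0) => j kj jmax; exists j => //.
apply/forallP => m; apply/negP => jm; suff /jmax : (k == m) || prec k m.
  by rewrite /= leqNgt height_lt.
by case/orP: kj => [/eqP ->|kj]; rewrite ?jm ?(prec_trans kj jm) orbT.
Qed.

Definition between (i j : 'I_n) : {set 'I_n} := [set k | prec i k && prec k j].

End ExtremePairs.

(** * The unitriangular group 1 + L *)

Section CircleGroup.

Variables (n : nat) (prec : strict_order n) (R : comNzRingType).
Local Notation L := (pattern_lie prec R).

(* The group law of 1 + L transported along g |-> 1 + g. *)
Fact circ_proof (g h : L) :
  val g + val h + val g *m val h \in pattern_mx prec (R := R).
Proof. by rewrite !rpredD ?pattern_mxM ?pattern_valP. Qed.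

Definition circ (g h : L) : L := PatternLie (circ_proof g h).

Lemma circE (g h : L) i j :
  val (circ g h) i j = val g i j + val h i j + \sum_m val g i m * val h m j.
Proof. by rewrite !mxE. Qed.

Lemma circ0 g : circ g 0 = g.
Proof. by apply: val_inj; rewrite /= mulmx0 !addr0. Qed.

Lemma pattern_eq0 (g : L) i j : ~~ prec i j -> val g i j = 0.
Proof. exact: (pattern_mx0P _ _ (pattern_valP g)). Qed.

(** In a fixed column, let k be an index of greatest height at which [h1] and [h2] differ. In row k
    the products with [g] involve only indices of greater height, where the two agree, so they agree
    at k as well. *)
Lemma circ_injr (g h1 h2 : L) : circ g h1 = circ g h2 -> h1 = h2.
Proof.
move=> e; apply: val_inj; apply/matrixP => i j; apply/eqP; rewrite -subr_eq0.
pose w m := val h1 m j - val h2 m j; apply: contraT => wi0.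
case: (@arg_maxnP _ i (fun m => w m != 0) (height prec) wi0) => {wi0}k wk kmax.
suff wk0 : w k = 0 by rewrite wk0 eqxx in wk.
have := congr1 (fun u : L => val u k j) e; rewrite !circE -!addrA => /addrI/eqP.
rewrite -subr_eq0 opprD addrACA -sumrB -/(w k).
rewrite big1 ?addr0 => [/eqP //|m _]; rewrite -mulrBr -/(w m).
have [km|/pattern_eq0->] := boolP (prec k m); last by rewrite mul0r.
have [->|/kmax] := eqVneq (w m) 0; first by rewrite mulr0.
by rewrite /= leqNgt height_lt.
Qed.

End CircleGroup.

Lemma circ_inv_exists (n : nat) (prec : strict_order n) (F : finFieldType)
  (g : pattern_lie prec F) : exists h, circ g h = 0.
Proof.
have [h _ hK] := injF_bij (@circ_injr n prec F g).
by exists (h 0); rewrite hK.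
Qed.

(** * Monomial matrices from a right action and a cocycle *)

Section MonomialMatrices.

Variables (T : finType) (C : fieldType) (G : Type) (op : G -> G -> G).
Variables (act : G -> T -> T) (coc : G -> T -> C).
Hypothesis act_op : forall g h u, act (op g h) u = act h (act g u).
Hypothesis coc_op : forall g h u, coc (op g h) u = coc g u * coc h (act g u).

Definition monomial_mx (g : G) : 'M[C]_#|T| :=
  \matrix_(s, t) (coc g (enum_val s) *+ (act g (enum_val s) == enum_val t)).

Lemma monomial_mxM g h : monomial_mx (op g h) = monomial_mx g *m monomial_mx h.
Proof.
apply/matrixP => s t; rewrite [RHS]mxE (bigD1 (enum_rank (act g (enum_val s)))) //.
rewrite [X in _ = _ + X]big1 => [|k /eqP kn].
  rewrite addr0 !mxE enum_rankK eqxx mulr1n coc_op act_op.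
  by rewrite [RHS]mulrnAr.
rewrite mxE; case: eqP => [sk|_]; last by rewrite mulr0n mul0r.
by case: kn; rewrite sk enum_valK.
Qed.

Lemma monomial_mx_one g :
  (forall u, act g u = u) -> (forall u, coc g u = 1) -> monomial_mx g = 1%:M.
Proof.
move=> act1 coc1; apply/matrixP => s t.
by rewrite !mxE act1 coc1 (inj_eq enum_val_inj).
Qed.

Lemma monomial_mx_eq g h u : coc g u != 0 -> monomial_mx g = monomial_mx h ->
  act g u = act h u /\ coc g u = coc h u.
Proof.
move=> c0 /(congr1 (fun M : 'M__ => M (enum_rank u) (enum_rank (act g u)))).
rewrite /= !mxE !enum_rankK eqxx mulr1n; case: eqP => [->//|_ /eqP].
by rewrite mulr0n (negPf c0).
Qed.

End MonomialMatrices.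

(** * The upper bound: a faithful monomial representation *)

Section MonomialRepresentation.

Variables (n : nat) (prec : strict_order n) (F : finFieldType) (f : nat).
Variables (C : fieldType) (Q : zmodType) (e : Q -> C) (c : F -> 'rV[Q]_f).
Hypothesis e0 : e 0 = 1.
Hypothesis eD : {morph e : u v / u + v >-> u * v}.
Hypothesis e_inj : injective e.
Hypothesis c_add : zmod_morphism c.
Hypothesis c_inj : injective c.
Hypothesis f_gt0 : (0 < f)%N.
Local Notation L := (pattern_lie prec F).

Definition supported (ij : 'I_n * 'I_n) (r : {ffun 'I_n -> F}) : bool :=
  r \in pffun_on 0 (between prec ij.1 ij.2) predT.

Lemma supportedP ij (r : {ffun 'I_n -> F}) :
  reflect (forall k, k \notin between prec ij.1 ij.2 -> r k = 0) (supported ij r).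
Proof.
apply: (iffP pffun_onP) => [[/subsetP sr _] k|r0].
  by apply: contraNeq => rk; apply: sr; rewrite unfold_in.
split=> [|x _ //]; apply/subsetP => k; rewrite unfold_in => rk.
by apply: contraR rk => /r0 ->; rewrite eqxx.
Qed.

(** An index combines an extreme pair, a coordinate of F over F_p and a row, so that the direct sum
    of all the monomial representations is itself a single monomial representation. *)
Definition monomial_index_pred (u : ('I_n * 'I_n) * 'I_f * {ffun 'I_n -> F}) : bool :=
  (u.1.1 \in extreme_pairs prec) && supported u.1.1 u.2.
Definition monomial_index : Type := {u | monomial_index_pred u}.
HB.instance Definition _ := Finite.on monomial_index.

Lemma card_monomial_index : #|{: monomial_index}| =
  (\sum_(ij in extreme_pairs prec) f * #|F| ^ prec_alpha prec ij.1 ij.2)%N.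
Proof.
rewrite card_sig -sum1_card.
transitivity (\sum_(ij in extreme_pairs prec) \sum_(l < f)
   \sum_(r : {ffun 'I_n -> F} | supported ij r) 1)%N.
  rewrite (pair_big_dep _ _ (fun ij (l : 'I_f) => \sum_(r | supported ij r) 1)%N).
  rewrite (pair_big_dep _ _ (fun v r => 1)%N) /=.
  by apply: eq_bigl => -[[ij l] r]; rewrite /= andbT.
apply: eq_bigr => ij _; rewrite sum_nat_const card_ord; congr (_ * _)%N.
by rewrite -(card_pffun_on 0 (between prec ij.1 ij.2) (predT : pred F)) -sum1_card.
Qed.

(* The k-th coordinate of (e_i + r)(1 + g), for k <> i. *)
Definition row_move (g : L) (i : 'I_n) (r : {ffun 'I_n -> F}) k : F :=
  r k + val g i k + \sum_m r m * val g m k.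

Lemma row_move_zero g i k : row_move g i [ffun=> 0] k = val g i k.
Proof.
rewrite /row_move ffunE add0r big1 ?addr0 // => m _.
by rewrite ffunE mul0r.
Qed.

Lemma row_move_delta g i k l :
  row_move g i [ffun m => (m == k)%:R] l = (l == k)%:R + val g i l + val g k l.
Proof.
rewrite /row_move ffunE (bigD1 k) //= ffunE eqxx mul1r big1 ?addr0 // => m /negPf mk.
by rewrite ffunE mk mul0r.
Qed.

Definition row_act ij (g : L) (r : {ffun 'I_n -> F}) : {ffun 'I_n -> F} :=
  [ffun k => if k \in between prec ij.1 ij.2 then row_move g ij.1 r k else 0].

Lemma row_act_supported ij g r : supported ij (row_act ij g r).
Proof. by apply/supportedP => k /negPf nk; rewrite ffunE nk. Qed.

(** This is associativity of (e_i + r)(1 + g)(1 + h), read at position k. *)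
Lemma row_move_circ ij g h r k : supported ij r ->
  k \in between prec ij.1 ij.2 \/ k = ij.2 ->
  row_move (circ g h) ij.1 r k = row_move g ij.1 r k + val h ij.1 k +
     \sum_m row_act ij g r m * val h m k.
Proof.
case: ij => i j /= /supportedP /= r0 kij.
(* The coordinates that [row_act] discards do not matter: such an m either does not precede k, or
   does not lie above i, and in the latter case the moved row is zero at m. *)
have actE m : row_act (i, j) g r m * val h m k = row_move g i r m * val h m k.
  rewrite ffunE /=; case: ifPn => // mij.
  have [mk|/pattern_eq0->] := boolP (prec m k); last by rewrite !mulr0.
  have mj : prec m j.
    by case: kij => [|<- //]; rewrite inE => /andP[_]; apply: prec_trans.
  rewrite inE mj andbT in mij; rewrite /row_move r0 ?inE ?mj ?andbT // pattern_eq0 //.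
  rewrite !add0r big1 // => l _.
  have [li|/r0->] := boolP (l \in between prec i j); last by rewrite mul0r.
  rewrite pattern_eq0 ?mulr0 //; apply: contra mij; apply: prec_trans.
  by move: li; rewrite inE => /andP[].
rewrite (eq_bigr _ (fun m _ => actE m)) /row_move circE.
under [X in _ + X = _]eq_bigr do rewrite circE.
have -> : \sum_m r m * (val g m k + val h m k + \sum_l val g m l * val h l k) =
    \sum_m r m * val g m k + \sum_m r m * val h m k +
    \sum_m \sum_l r m * val g m l * val h l k.
  rewrite -!big_split; apply: eq_bigr => m _; rewrite !mulrDr mulr_sumr.
  by congr (_ + _); apply: eq_bigr => l _; rewrite mulrA.
have -> : \sum_m (r m + val g i m + \sum_l r l * val g l m) * val h m k =
    \sum_m r m * val h m k + \sum_m val g i m * val h m k +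
    \sum_l \sum_m r l * val g l m * val h m k.
  rewrite [X in _ = _ + X]exchange_big -!big_split; apply: eq_bigr => m _.
  by rewrite !mulrDl mulr_suml.
ring.
Qed.

Lemma act_proof (g : L) (u : monomial_index) :
  monomial_index_pred ((val u).1, row_act (val u).1.1 g (val u).2).
Proof.
by have /andP[ex _] := valP u; rewrite /monomial_index_pred /= ex row_act_supported.
Qed.

Definition act (g : L) (u : monomial_index) : monomial_index :=
  exist (fun v => is_true (monomial_index_pred v)) _ (act_proof g u).

Definition cocycle (g : L) (u : monomial_index) : C :=
  e (c (row_move g (val u).1.1.1 (val u).2 (val u).1.1.2) 0 (val u).1.2).

Lemma supported_valP (u : monomial_index) : supported (val u).1.1 (val u).2.
Proof. by have /andP[] := valP u. Qed.

Lemma act_circ g h u : act (circ g h) u = act h (act g u).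
Proof.
apply: val_inj; rewrite /=; congr (_, _); apply/ffunP => k; rewrite [in LHS]ffunE [in RHS]ffunE.
case: ifPn => // kb; rewrite (row_move_circ _ _ (supported_valP u)); last by left.
by rewrite [in RHS]/row_move [in RHS]ffunE kb.
Qed.

Lemma c_addD x y : c (x + y) = c x + c y.
Proof.
have c0 : c 0 = 0 by rewrite -(subrr 0) c_add subrr.
have cN z : c (- z) = - c z by rewrite -(sub0r z) c_add c0 sub0r.
by rewrite -{1}(opprK y) c_add cN opprK.
Qed.

Lemma cocycle_circ g h u : cocycle (circ g h) u = cocycle g u * cocycle h (act g u).
Proof.
rewrite /cocycle (row_move_circ _ _ (supported_valP u)); last by right.
rewrite -addrA c_addD mxE eD; congr (_ * e (c _ 0 _)); rewrite /= /row_move.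
have -> : row_act (val u).1.1 g (val u).2 (val u).1.1.2 = 0.
  by rewrite ffunE inE prec_irr andbF.
by rewrite add0r.
Qed.

Lemma e_neq0 u : e u != 0.
Proof.
apply/eqP => eu0; have := eD u (- u); rewrite subrr e0 eu0 mul0r => /eqP.
by rewrite oner_eq0.
Qed.

Definition pattern_rep (g : L) : 'M[C]_#|{: monomial_index}| :=
  monomial_mx act cocycle g.

Lemma pattern_repM g h : pattern_rep (circ g h) = pattern_rep g *m pattern_rep h.
Proof. exact: (monomial_mxM act_circ cocycle_circ). Qed.

Lemma pattern_rep0 : pattern_rep 0 = 1%:M.
Proof.
have move0 i r k : row_move 0 i r k = r k.
  by rewrite /row_move mxE addr0 big1 ?addr0 // => m _; rewrite mxE mulr0.
apply: monomial_mx_one => u.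
  apply: val_inj; case: u => -[[ij l] r] /= ur; congr (_, _); apply/ffunP => k.
  rewrite ffunE move0; case: ifPn => // kb.
  by have /andP[_ /supportedP->] := ur.
rewrite /cocycle move0.
have /supportedP-> := supported_valP u; last by rewrite inE prec_irr andbF.
by have := c_add 0 0; rewrite !subrr => ->; rewrite mxE e0.
Qed.

(** The entry (k, l) is seen in an extreme pair (i, j) with i at or below k and j at or above l: the
    row 0 reveals the entry (i, l), and if k differs from i, the row e_k reveals the sum of the
    entries (i, l) and (k, l). *)
Lemma pattern_rep_inj : injective pattern_rep.
Proof.
move=> g h gh.
have eqs u : act g u = act h u /\ cocycle g u = cocycle h u.
  exact: (monomial_mx_eq (e_neq0 _) gh).
have eqm i j (r : {ffun 'I_n -> F}) k :
    prec_minimal prec i -> prec_maximal prec j -> prec i j -> supported (i, j) r ->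
    k \in between prec i j \/ k = j -> row_move g i r k = row_move h i r k.
  move=> imin jmax ij rs.
  have ex l : monomial_index_pred (i, j, l, r).
    by rewrite /monomial_index_pred inE /= imin jmax ij rs.
  pose idx l : monomial_index :=
    exist (fun v => is_true (monomial_index_pred v)) (i, j, l, r) (ex l).
  (* Inside the interval the action shows the coordinate, for any one index below f. At j, the f
     cocycle values together determine an element of F. *)
  case=> [kb|->].
    have [/(congr1 val)/= [/ffunP/(_ k)]] := eqs (idx (Ordinal f_gt0)).
    by rewrite !ffunE /= kb.
  apply: c_inj; apply/rowP => l.
  by have [_ /e_inj] := eqs (idx l).
apply: val_inj; apply/matrixP => k l.
have [kl|nkl] := boolP (prec k l); last by rewrite !pattern_eq0.
have [i imin ik] := minimal_below prec k; have [j jmax lj] := maximal_above prec l.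
have il : prec i l by case/orP: ik => [/eqP-> //|ik]; apply: prec_trans kl.
have ij : prec i j by case/orP: lj => [/eqP<- //|lj]; apply: prec_trans lj.
have lb : l \in between prec i j \/ l = j.
  by case/orP: lj => [/eqP->|lj]; [right | left; rewrite inE il].
have s0 : supported (i, j) [ffun=> 0] by apply/supportedP => m _; rewrite ffunE.
have gil : val g i l = val h i l.
  by have := eqm _ _ _ _ imin jmax ij s0 lb; rewrite !row_move_zero.
case/orP: ik => [/eqP<- //|ik].
have kj : prec k j by case/orP: lj => [/eqP<- //|lj]; apply: prec_trans lj.
have s1 : supported (i, j) [ffun m => (m == k)%:R].
  apply/supportedP => m mb; rewrite ffunE; have [mk|//] := eqVneq m k.
  by move: mb; rewrite mk inE /= ik kj.
have := eqm _ _ _ _ imin jmax ij s1 lb; rewrite !row_move_delta gil.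
exact: addrI.
Qed.

Lemma pattern_rep_unit g : pattern_rep g \in unitmx.
Proof.
have [h gh] := circ_inv_exists g.
have e1 := pattern_repM g h; rewrite gh in e1; rewrite pattern_rep0 in e1.
exact: (proj1 (mulmx1_unit (esym e1))).
Qed.

End MonomialRepresentation.

(** The factors of the full-rank factorization of [E] multiply to the identity in the reverse order,
    and the trace is cyclic. *)
Lemma mxtrace_idem (C : fieldType) d (E : 'M[C]_d) :
  E *m E = E -> \tr E = (\rank E)%:R.
Proof.
move=> idE;
have e1 : row_base E *m col_base E = 1%:M.
  apply: (row_free_inj (row_base_free E)); apply: (row_full_inj (col_base_full E)).
  rewrite mul1mx -(mulmxA (row_base E)) mulmx_base (mulmxA (col_base E)).
  by rewrite mulmx_base idE.
by rewrite -[in LHS](mulmx_base E) mxtrace_mulC e1 mxtrace1.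
Qed.

(** * Eigenspace projectors for the characters of a finite abelian group *)

Section CharacterProjectors.

Variables (V : finZmodType) (C : numFieldType) (beta : V -> V -> C).
Hypothesis betaDl : forall v, {morph beta^~ v : c1 c2 / c1 + c2 >-> c1 * c2}.
Hypothesis betaDr : forall c, {morph beta c : v w / v + w >-> v * w}.
Hypothesis beta_l : forall c, c != 0 -> exists v, beta c v != 1.
Hypothesis beta_r : forall v, v != 0 -> exists c, beta c v != 1.
Hypothesis beta0l : forall v, beta 0 v = 1.
Hypothesis beta0r : forall c, beta c 0 = 1.

Lemma sum_char0 (chi : V -> C) v0 :
  {morph chi : v w / v + w >-> v * w} -> chi v0 != 1 -> \sum_v chi v = 0.
Proof.
move=> chiD chi1; apply/eqP; have : (chi v0 - 1) * \sum_v chi v == 0.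
  rewrite mulrBl mul1r mulr_sumr subr_eq0; apply/eqP.
  rewrite [RHS](reindex_inj (addrI v0)) /=; apply: eq_bigr => v _.
  by rewrite chiD.
by rewrite mulf_eq0 subr_eq0 (negPf chi1).
Qed.

Lemma cardV_neq0 : #|V|%:R != 0 :> C.
Proof. by rewrite pnatr_eq0 -lt0n; apply/card_gt0P; exists 0. Qed.

Lemma beta_neq0 c v : beta c v != 0.
Proof.
apply/eqP => b0; have := betaDr c v (- v); rewrite subrr beta0r b0 mul0r => /eqP.
by rewrite oner_eq0.
Qed.

Lemma betaNr c v : beta c (- v) = (beta c v)^-1.
Proof.
by apply: (mulfI (beta_neq0 c v)); rewrite -betaDr subrr beta0r divff ?beta_neq0.
Qed.

Lemma betaNl c v : beta (- c) v = (beta c v)^-1.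
Proof.
by apply: (mulfI (beta_neq0 c v)); rewrite -betaDl subrr beta0l divff ?beta_neq0.
Qed.

Variables (d : nat) (rho : V -> 'M[C]_d).
Hypothesis rhoD : {morph rho : v w / v + w >-> v *m w}.
Hypothesis rho0 : rho 0 = 1%:M.

(** The averaging projector onto the space where each [rho v] acts as the scalar [beta c v]. *)
Definition char_proj (c : V) : 'M[C]_d :=
  #|V|%:R^-1 *: \sum_v beta c (- v) *: rho v.

Lemma rho_char_proj w c : rho w *m char_proj c = beta c w *: char_proj c.
Proof.
rewrite /char_proj -scalemxAr scalerA mulrC -scalerA; congr (_ *: _).
rewrite mulmx_sumr scaler_sumr [RHS](reindex_inj (addrI w)) /=.
apply: eq_bigr => v _; rewrite -scalemxAr -rhoD scalerA; congr (_ *: _).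
by rewrite -betaDr opprD addrA subrr add0r.
Qed.

Lemma char_projM c1 c2 :
  char_proj c1 *m char_proj c2 = if c1 == c2 then char_proj c2 else 0.
Proof.
rewrite {1}/char_proj -scalemxAl mulmx_suml.
transitivity ((#|V|%:R^-1 * \sum_v beta (c2 - c1) v) *: char_proj c2).
  rewrite -scalerA scaler_suml; congr (_ *: _); apply: eq_bigr => v _.
  by rewrite -scalemxAl rho_char_proj scalerA betaDl betaNl betaNr mulrC.
case: eqP => [->|c12].
  rewrite subrr (eq_bigr _ (fun v _ => beta0l v)) sumr_const.
  by rewrite mulVf ?scale1r ?cardV_neq0.
have [v0 v01] : exists v, beta (c2 - c1) v != 1.
  by apply: beta_l; rewrite subr_eq0 eq_sym; apply/eqP.
by rewrite (sum_char0 (betaDr _) v01) mulr0 scale0r.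
Qed.

Lemma sum_char_proj : \sum_c char_proj c = 1%:M.
Proof.
rewrite -scaler_sumr exchange_big /= (bigD1 0) //= [X in _ + X]big1 => [|v v0].
  rewrite addr0 rho0 -scaler_suml scalerA oppr0.
  rewrite (eq_bigr _ (fun c _ => beta0r c)) sumr_const.
  by rewrite mulVf ?scale1r ?cardV_neq0.
have [c c1] : exists c, beta c (- v) != 1 by apply: beta_r; rewrite oppr_eq0.
by rewrite -scaler_suml (sum_char0 (betaDl _) c1) scale0r.
Qed.

Lemma rho_sum_char_proj w : rho w = \sum_c beta c w *: char_proj c.
Proof.
rewrite -[LHS]mulmx1 -sum_char_proj mulmx_sumr.
by apply: eq_bigr => c _; rewrite rho_char_proj.
Qed.

Lemma char_proj_comm (X : 'M[C]_d) c :
  (forall v, rho v *m X = X *m rho v) -> char_proj c *m X = X *m char_proj c.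
Proof.
move=> rX; rewrite /char_proj -scalemxAl -scalemxAr mulmx_suml mulmx_sumr.
by congr (_ *: _); apply: eq_bigr => v _; rewrite -scalemxAl -scalemxAr rX.
Qed.

(** In characteristic zero the ranks of idempotents can be read off from their traces, and the
    projectors add up to the identity. *)
Lemma sum_rank_char_proj : (\sum_c \rank (char_proj c))%N = d.
Proof.
apply/eqP; rewrite -(eqr_nat C) natr_sum -(mxtrace1 C d) -sum_char_proj raddf_sum /=.
by apply/eqP; apply: eq_bigr => c _; rewrite mxtrace_idem // char_projM eqxx.
Qed.

End CharacterProjectors.

(** * The pairing of K^m with itself given by an additive character *)

Section DotCharacter.

Variables (K : finFieldType) (C : numFieldType) (psi : K -> C) (m : nat) (t0 : K).
Hypothesis psiD : {morph psi : x y / x + y >-> x * y}.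
Hypothesis psi0 : psi 0 = 1.
Hypothesis psi_t0 : psi t0 != 1.

Definition dot_char (a b : 'rV[K]_m) : C := psi (\sum_k a 0 k * b 0 k).

Lemma dot_charDr a : {morph dot_char a : b1 b2 / b1 + b2 >-> b1 * b2}.
Proof.
move=> b1 b2; rewrite /dot_char -psiD -big_split; congr psi.
by apply: eq_bigr => k _; rewrite mxE mulrDr.
Qed.

Lemma dot_charC a b : dot_char a b = dot_char b a.
Proof. by congr psi; apply: eq_bigr => k _; rewrite mulrC. Qed.

Lemma dot_charDl b : {morph dot_char^~ b : a1 a2 / a1 + a2 >-> a1 * a2}.
Proof. by move=> a1 a2; rewrite !(dot_charC _ b) dot_charDr. Qed.

Lemma dot_char0r a : dot_char a 0 = 1.
Proof. by rewrite /dot_char big1 ?psi0 // => k _; rewrite mxE mulr0. Qed.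

Lemma dot_char0l b : dot_char 0 b = 1.
Proof. by rewrite dot_charC dot_char0r. Qed.

Lemma dot_char_nondegl a : a != 0 -> exists b, dot_char a b != 1.
Proof.
move=> a0; have [k ak] : exists k, a 0 k != 0.
  apply/existsP; apply: contraNT a0 => /existsPn ak; apply/eqP/rowP => k.
  by rewrite mxE; apply/eqP; rewrite -[_ == _]negbK.
(* This vector has dot product [t0] with [a]. *)
exists (\row_l (t0 / a 0 k *+ (l == k))).
rewrite /dot_char (bigD1 k) //= big1 => [|l /negPf lk]; rewrite mxE.
  by rewrite eqxx mulr1n addr0 mulrC divfK.
by rewrite lk mulr0n mulr0.
Qed.

Lemma dot_char_nondegr b : b != 0 -> exists a, dot_char a b != 1.
Proof. by move=> /dot_char_nondegl[a ab]; exists a; rewrite dot_charC. Qed.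

End DotCharacter.

(** * Ranks of spaces carrying Heisenberg relations *)

Section HeisenbergRank.

Variables (K : finFieldType) (C : numFieldType) (psi : K -> C) (m d : nat) (t0 : K).
Hypothesis psiD : {morph psi : x y / x + y >-> x * y}.
Hypothesis psi0 : psi 0 = 1.
Hypothesis psi_t0 : psi t0 != 1.
Variables (P : 'M[C]_d) (rx ry : 'rV[K]_m -> 'M[C]_d).
Hypothesis P_idem : P *m P = P.
Hypothesis rxD : {morph rx : a1 a2 / a1 + a2 >-> a1 *m a2}.
Hypothesis rx0 : rx 0 = 1%:M.
Hypothesis rxP : forall a, rx a *m P = P *m rx a.
Hypothesis ryP : forall b, ry b *m P = P *m ry b.
Hypothesis ry_unit : forall b, ry b \in unitmx.
Hypothesis rx_ry : forall a b,
  rx a *m ry b *m P = dot_char psi a b *: (ry b *m rx a *m P).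

(* The operators ry b permute the eigenspaces of rx on the image of P
   simply transitively, so these all have the same dimension. *)
Lemma rank_heisenberg : exists r, \rank P = (#|K| ^ m * r)%N.
Proof.
pose pr b := char_proj (@dot_char _ _ psi m) rx b.
have bDl : forall v, {morph (@dot_char _ _ psi m)^~ v : c1 c2 / c1 + c2 >-> c1 * c2}.
  exact: dot_charDl.
have bDr : forall c, {morph (@dot_char _ _ psi m) c : v w / v + w >-> v * w}.
  exact: dot_charDr.
have bl : forall v : 'rV[K]_m, v != 0 -> exists c, dot_char psi v c != 1.
  exact: dot_char_nondegl psi_t0.
have br : forall v : 'rV[K]_m, v != 0 -> exists c, dot_char psi c v != 1.
  exact: dot_char_nondegr psi_t0.
have b0l : forall c, (@dot_char _ _ psi m) 0 c = 1 by exact: dot_char0l.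
have b0r : forall c, (@dot_char _ _ psi m) c 0 = 1 by exact: dot_char0r.
have prP b : pr b *m P = P *m pr b by apply: char_proj_comm => v; apply: rxP.
(* Moving [rx a] past [ry b] produces the factor [dot_char psi a b], which cancels the weight of
   [rx a] in [pr b]. Thus [pr b *m P] and [pr 0 *m P] are conjugate. *)
have pr_ry b : pr b *m P *m ry b = ry b *m (pr 0 *m P).
  rewrite -mulmxA -ryP !mulmxA /pr /char_proj -!scalemxAl -!scalemxAr -!scalemxAl.
  congr (_ *: _); rewrite !(mulmx_suml, mulmx_sumr); apply: eq_bigr => a _.
  rewrite -!scalemxAl -!scalemxAr -!scalemxAl rx_ry scalerA b0l scale1r.
  rewrite (betaNr bDr b0r) (dot_charC psi b) mulVf ?scale1r //.
  exact: (beta_neq0 bDr b0r).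
have tr_pr b : \tr (pr b *m P) = \tr (pr 0 *m P).
  rewrite -[pr b *m P](mulmxK (ry_unit b)) pr_ry mxtrace_mulC !mulmxA mulVmx //.
  by rewrite mul1mx.
exists (\rank (pr 0 *m P)); apply/eqP; rewrite -(eqr_nat C) natrM -!mxtrace_idem //.
  rewrite -{1}[P]mul1mx -(sum_char_proj bDl br b0r rx0) mulmx_suml raddf_sum /=.
  rewrite (eq_bigr _ (fun b _ => tr_pr b)) sumr_const card_mx mul1n.
  by rewrite mulr_natl.
(* A product of commuting idempotents is idempotent. *)
rewrite -mulmxA (mulmxA P) -prP -!mulmxA P_idem mulmxA.
by rewrite (char_projM bDl bDr bl b0l b0r rxD) eqxx.
Qed.

End HeisenbergRank.

(** * The lower bound: central characters in a faithful representation *)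

Section LowerBound.

Variables (n : nat) (prec : strict_order n) (F : finFieldType) (p f : nat).
Variables (C : numFieldType) (e : 'F_p -> C).
Variables (c : F -> 'rV['F_p]_f) (cinv : 'rV['F_p]_f -> F).
Hypothesis e0 : e 0 = 1.
Hypothesis eD : {morph e : u v / u + v >-> u * v}.
Hypothesis e_inj : injective e.
Hypothesis cB : zmod_morphism c.
Hypothesis cK : cancel c cinv.
Hypothesis cinvK : cancel cinv c.
Local Notation L := (pattern_lie prec F).

Variables (d : nat) (rho : L -> 'M[C]_d).
Hypothesis rhoM : {morph rho : g h / circ g h >-> g *m h}.
Hypothesis rho_unit : forall g, rho g \in unitmx.
Hypothesis rho_inj : injective rho.

Lemma rho0 : rho 0 = 1%:M.
Proof.
by apply: (can_inj (mulKmx (rho_unit 0))); rewrite -rhoM circ0 mulmx1.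
Qed.

Lemma cinvD u v : cinv (u + v) = cinv u + cinv v.
Proof. by apply: (can_inj cK); rewrite (c_addD cB) !cinvK. Qed.

Lemma cinv0 : cinv 0 = 0.
Proof. by apply: (addrI (cinv 0)); rewrite -cinvD !addr0. Qed.

(** The F_p-coordinates of the central subgroup spanned by the extreme positions. *)
Definition center_index : Type :=
  ({ij : 'I_n * 'I_n | ij \in extreme_pairs prec} * 'I_f)%type.
HB.instance Definition _ := Finite.on center_index.
Local Notation N := #|{: center_index}|.
Local Notation V := 'rV['F_p]_N.

Definition center_coord (v : V) (ij : 'I_n * 'I_n) : 'rV['F_p]_f :=
  \row_l if insub ij is Some k then v 0 (enum_rank ((k, l) : center_index)) else 0.

Lemma center_coordD v w ij : center_coord (v + w) ij = center_coord v ij + center_coord w ij.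
Proof. by apply/rowP => l; rewrite !mxE; case: insub => [k|]; rewrite ?mxE ?addr0. Qed.

Lemma center_coord_out v ij : ij \notin extreme_pairs prec -> center_coord v ij = 0.
Proof. by move=> nij; apply/rowP => l; rewrite !mxE insubN. Qed.

Fact center_proof (v : V) :
  \matrix_(i, j) cinv (center_coord v (i, j)) \in pattern_mx prec (R := F).
Proof.
apply/pattern_mx0P => i j nij; rewrite mxE center_coord_out ?cinv0 //.
by rewrite inE /= (negPf nij) !andbF.
Qed.

Definition center_elem (v : V) : L := PatternLie (center_proof v).

Lemma center_elemE v i j : val (center_elem v) i j = cinv (center_coord v (i, j)).
Proof. exact: mxE. Qed.

(** A nonzero entry of a central element lies in a column m with m maximal, and then row m of [g] is
    zero. *)
Lemma center_elem_mull v (g : L) : val (center_elem v) *m val g = 0.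
Proof.
apply/matrixP => i j; rewrite !mxE big1 // => m _; rewrite mxE.
have [im|nim] := boolP ((i, m) \in extreme_pairs prec); last first.
  by rewrite center_coord_out // cinv0 mul0r.
rewrite [val g m j]pattern_eq0 ?mulr0 //.
by move: im; rewrite inE => /and3P[_ /forallP/(_ j)].
Qed.

Lemma center_elem_mulr v (g : L) : val g *m val (center_elem v) = 0.
Proof.
apply/matrixP => i j; rewrite !mxE big1 // => m _; rewrite [X in _ * X]mxE.
have [mj|nmj] := boolP ((m, j) \in extreme_pairs prec); last first.
  by rewrite center_coord_out // cinv0 mulr0.
rewrite [val g i m]pattern_eq0 ?mul0r //.
by move: mj; rewrite inE => /and3P[/forallP/(_ i)].
Qed.

Lemma center_elemD v w : center_elem (v + w) = circ (center_elem v) (center_elem w).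
Proof.
apply: val_inj; change (val (center_elem (v + w)) = val (center_elem v) +
  val (center_elem w) + val (center_elem v) *m val (center_elem w)).
rewrite center_elem_mull addr0.
by apply/matrixP => i j; rewrite !mxE center_coordD cinvD.
Qed.

Lemma center_elemC v g : circ (center_elem v) g = circ g (center_elem v).
Proof.
apply: val_inj; change (val (center_elem v) + val g + val (center_elem v) *m val g =
  val g + val (center_elem v) + val g *m val (center_elem v)).
by rewrite center_elem_mull center_elem_mulr !addr0 addrC.
Qed.

Lemma center_elem0 : center_elem 0 = 0.
Proof.
apply: val_inj; apply/matrixP => i j; rewrite !mxE -[RHS]cinv0; congr cinv.
by apply/rowP => l; rewrite !mxE; case: insub => [k|]; rewrite ?mxE.
Qed.

Lemma center_elem_inj : injective center_elem.
Proof.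
move=> v w vw; apply/rowP => s; rewrite -(enum_valK s); case: (enum_val s) => -[ij ex] l.
have := congr1 (fun g : L => val g ij.1 ij.2) vw; rewrite !center_elemE.
move=> /(can_inj cinvK)/rowP/(_ l); rewrite !mxE -surjective_pairing.
by rewrite insubT.
Qed.

Let rhoZ v := rho (center_elem v).
Let rhoZD : {morph rhoZ : v w / v + w >-> v *m w}.
Proof. by move=> v w; rewrite /rhoZ center_elemD rhoM. Qed.
Let rhoZ0 : rhoZ 0 = 1%:M.
Proof. by rewrite /rhoZ center_elem0 rho0. Qed.

Let t1 : 'F_p := 1.
Let e_t1 : e t1 != 1.
Proof. by rewrite -e0 (inj_eq e_inj) oner_eq0. Qed.

Let beta : V -> V -> C := @dot_char _ C e _.
Let E (s : V) := char_proj beta rhoZ s.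

Lemma sum_rank_center : (\sum_s \rank (E s))%N = d.
Proof.
apply: sum_rank_char_proj => //.
- exact: dot_charDl.
- exact: dot_charDr.
- exact: (dot_char_nondegl e_t1).
- exact: (dot_char_nondegr e_t1).
- exact: dot_char0l.
- exact: dot_char0r.
Qed.

(** The central element of such a [v] acts as the identity on every eigenspace, so faithfulness
    forces it to be trivial. Hence the occurring characters span the dual space. *)
Lemma center_kernel (v : V) :
  (forall s, E s != 0 -> \sum_k s 0 k * v 0 k = 0) -> v = 0.
Proof.
move=> Ev; apply: center_elem_inj; apply: rho_inj; rewrite -!/(rhoZ _) rhoZ0.
have bDl : forall v, {morph beta^~ v : c1 c2 / c1 + c2 >-> c1 * c2} by exact: dot_charDl.
have bDr : forall c, {morph beta c : v w / v + w >-> v * w} by exact: dot_charDr.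
have br : forall v, v != 0 -> exists c, beta c v != 1 by exact: (dot_char_nondegr e_t1).
have b0r : forall c, beta c 0 = 1 by exact: dot_char0r.
rewrite (rho_sum_char_proj bDl bDr br b0r rhoZD rhoZ0).
rewrite -(sum_char_proj bDl br b0r rhoZ0).
apply: eq_bigr => s _; rewrite -/(E s); have [->|Es] := eqVneq (E s) 0; first by rewrite scaler0.
by rewrite /beta /dot_char Ev // e0 scale1r.
Qed.

(** * The Heisenberg subgroup of an extreme pair *)

Section PairCharacter.

Variables (s : V) (k0 : center_index).
Hypothesis Es_neq0 : E s != 0.
Hypothesis sk0 : s 0 (enum_rank k0) != 0.
Let i := (val k0.1).1.
Let j := (val k0.1).2.
Let B := between prec i j.

Lemma pair_lt : prec i j.
Proof. by have := valP k0.1; rewrite inE => /and3P[]. Qed.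

Definition pair_vec (t : F) : V :=
  \row_u (c t 0 (enum_val u).2 *+ ((enum_val u).1 == k0.1)).

Lemma pair_vecD t1' t2 : pair_vec (t1' + t2) = pair_vec t1' + pair_vec t2.
Proof. by apply/rowP => u; rewrite !mxE (c_addD cB) mxE mulrnDl. Qed.

Lemma val_pair_vec t : val (center_elem (pair_vec t)) = t *: delta_mx i j.
Proof.
apply/matrixP => m k; rewrite center_elemE !mxE.
have -> : center_coord (pair_vec t) (m, k) = c t *+ ((m == i) && (k == j)).
  apply/rowP => l; rewrite mxE mulmxnE -xpair_eqE /i /j -surjective_pairing.
  case: insubP => [q _ qE|nmk]; first by rewrite mxE enum_rankK /= -qE val_eqE.
  by case: eqP => // mk; rewrite mk (valP k0.1) in nmk.
by case: (_ && _); rewrite ?mulr1n ?mulr1 ?cK // !mulr0n mulr0 cinv0.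
Qed.

Let psi t := beta s (pair_vec t).

Lemma psiD : {morph psi : x y / x + y >-> x * y}.
Proof. by move=> x y; rewrite /psi pair_vecD; apply: dot_charDr. Qed.

Lemma psi0 : psi 0 = 1.
Proof.
rewrite /psi (_ : pair_vec 0 = 0); first exact: dot_char0r.
by apply: (addrI (pair_vec 0)); rewrite -pair_vecD !addr0.
Qed.

Lemma psi_neq1 : exists t, psi t != 1.
Proof.
(* This element is chosen so that the dot product with [s] reduces to the coordinate
   [s 0 (enum_rank k0)]. *)
exists (cinv (delta_mx 0 k0.2)); rewrite /psi /beta /dot_char (bigD1 (enum_rank k0)) //=.
rewrite big1 => [|u uk]; rewrite mxE cinvK mxE eqxx /=.
  by rewrite enum_rankK !eqxx mulr1n mulr1 addr0 -e0 (inj_eq e_inj).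
case: eqP => [l2|]; case: eqP => [l1|]; rewrite ?mulr0n ?mul0rn ?mulr0 //.
by case/eqP: uk; rewrite -(enum_valK u) (surjective_pairing (enum_val u)) l1 l2 -surjective_pairing.
Qed.

Fact row_elem_proof (a : 'rV[F]_#|B|) :
  \sum_q a 0 q *: delta_mx i (enum_val q) \in pattern_mx prec (R := F).
Proof.
apply/pattern_mx0P => m k nmk; rewrite summxE big1 // => q _; rewrite !mxE.
case: eqP => [mi|]; last by rewrite mulr0.
case: eqP => [kq|]; last by rewrite mulr0.
by case/negP: nmk; rewrite mi kq; have := enum_valP q; rewrite inE => /andP[].
Qed.
Definition row_elem a : L := PatternLie (row_elem_proof a).

Fact col_elem_proof (b : 'rV[F]_#|B|) :
  \sum_q b 0 q *: delta_mx (enum_val q) j \in pattern_mx prec (R := F).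
Proof.
apply/pattern_mx0P => m k nmk; rewrite summxE big1 // => q _; rewrite !mxE.
case: eqP => [mq|]; last by rewrite mulr0.
case: eqP => [kj|]; last by rewrite mulr0.
by case/negP: nmk; rewrite mq kj; have := enum_valP q; rewrite inE => /andP[].
Qed.
Definition col_elem b : L := PatternLie (col_elem_proof b).

Lemma row_row_mul a1 a2 : val (row_elem a1) *m val (row_elem a2) = 0.
Proof.
rewrite mulmx_suml big1 // => q _; rewrite mulmx_sumr big1 // => r _.
rewrite -scalemxAl -scalemxAr mul_delta_mx_0 ?scaler0 //.
by have := enum_valP q; rewrite inE; apply: contraTneq => ->; rewrite prec_irr.
Qed.

Lemma col_row_mul b a : val (col_elem b) *m val (row_elem a) = 0.
Proof.
rewrite mulmx_suml big1 // => q _; rewrite mulmx_sumr big1 // => r _.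
rewrite -scalemxAl -scalemxAr mul_delta_mx_0 ?scaler0 //.
by apply: contraTneq pair_lt => ->; rewrite prec_irr.
Qed.

Lemma row_col_mul a b :
  val (row_elem a) *m val (col_elem b) = (\sum_q a 0 q * b 0 q) *: delta_mx i j.
Proof.
rewrite mulmx_suml scaler_suml; apply: eq_bigr => q _.
rewrite mulmx_sumr (bigD1 q) //= big1 ?addr0 => [|r rq].
  by rewrite -scalemxAl -scalemxAr mul_delta_mx scalerA.
rewrite -scalemxAl -scalemxAr mul_delta_mx_0 ?scaler0 //.
by rewrite (inj_eq enum_val_inj) eq_sym.
Qed.

Lemma row_elemD a1 a2 : row_elem (a1 + a2) = circ (row_elem a1) (row_elem a2).
Proof.
apply: val_inj; change (val (row_elem (a1 + a2)) =
  val (row_elem a1) + val (row_elem a2) + val (row_elem a1) *m val (row_elem a2)).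
rewrite row_row_mul addr0 -big_split; apply: eq_bigr => q _.
by rewrite mxE scalerDl.
Qed.

(** A column element times a row element is zero because i differs from j, while the opposite
    product is the dot product at position (i, j), a central element. *)
Lemma row_col_circ a b : circ (row_elem a) (col_elem b) =
  circ (circ (col_elem b) (row_elem a)) (center_elem (pair_vec (\sum_q a 0 q * b 0 q))).
Proof.
set w := center_elem _; set g := circ (col_elem b) _.
apply: val_inj; change (val (row_elem a) + val (col_elem b) +
  val (row_elem a) *m val (col_elem b) = val (col_elem b) + val (row_elem a) +
  val (col_elem b) *m val (row_elem a) + val w + val g *m val w).
by rewrite center_elem_mulr addr0 col_row_mul addr0 row_col_mul val_pair_vec [in LHS](addrC (val _)).
Qed.

(** Row and column elements act on the eigenspace of [s] as a Heisenberg pair, so [rank_heisenberg]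
    makes its dimension a multiple of q^alpha(i, j), nonzero because the character occurs. *)
Lemma rank_pair_char : (#|F| ^ prec_alpha prec i j <= \rank (E s))%N.
Proof.
have [t0 psi_t0] := psi_neq1.
have bDl : forall v, {morph beta^~ v : c1 c2 / c1 + c2 >-> c1 * c2} by exact: dot_charDl.
have bDr : forall c, {morph beta c : v w / v + w >-> v * w} by exact: dot_charDr.
have bl : forall v, v != 0 -> exists c, beta v c != 1 by exact: (dot_char_nondegl e_t1).
have b0l : forall c, beta 0 c = 1 by exact: dot_char0l.
have b0r : forall c, beta c 0 = 1 by exact: dot_char0r.
have EC g : rho g *m E s = E s *m rho g.
  apply/esym/char_proj_comm => v; rewrite /rhoZ -!rhoM center_elemC //.
have [|||||||r rE] := @rank_heisenberg F C psi #|B| d t0 psiD psi0 psi_t0 (E s)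
    (fun a => rho (row_elem a)) (fun b => rho (col_elem b)).
- by rewrite (char_projM bDl bDr bl b0l b0r rhoZD) eqxx.
- by move=> a1 a2; rewrite row_elemD rhoM.
- rewrite -rho0; congr rho; apply: val_inj; rewrite /= big1 // => q _.
  by rewrite mxE scale0r.
- by move=> a; apply: EC.
- by move=> b; apply: EC.
- by move=> b; apply: rho_unit.
- move=> a b; rewrite -rhoM row_col_circ rhoM -mulmxA (rho_char_proj bDr rhoZD).
  by rewrite -scalemxAr rhoM.
rewrite rE leq_pmulr // lt0n; apply: contra Es_neq0 => /eqP r0.
by rewrite -mxrank_eq0 rE r0 muln0.
Qed.

End PairCharacter.

Lemma lower_bound :
  (\sum_(ij in extreme_pairs prec) f * #|F| ^ prec_alpha prec ij.1 ij.2 <= d)%N.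
Proof.
pose A := [set s : V | E s != 0].
pose M : 'M['F_p]_(#|A|, N) := \matrix_(x, k) (enum_val x : V) 0 k.
(* A column of the cokernel of [M] is annihilated by all occurring characters, so it is zero by
   [center_kernel]. *)
have fM : row_full M.
  rewrite -cokermx_eq0; apply/eqP/matrixP => k l; rewrite mxE.
  have := mulmx_coker M; set K := cokermx M => MK.
  suff /rowP/(_ k) : (col l K)^T = 0 by rewrite !mxE.
  apply: center_kernel => s Es; have sA : s \in A by rewrite inE.
  have /matrixP/(_ (enum_rank_in sA s) l) := MK; rewrite !mxE => sK.
  rewrite -[RHS]sK; apply: eq_bigr => u _.
  by rewrite !mxE enum_rankK_in.
(* The map [g] selects rows of [M] that form an invertible square matrix. *)
pose g := fullrankfun fM; pose G s : V := enum_val (g s).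
have G_inj : injective G by move=> s1 s2 /enum_val_inj/fullrankfun_inj.
(* A nonzero term of the Leibniz expansion of the determinant matches each selected character with a
   coordinate on which it is nontrivial. *)
have [sg Msg] : exists sg : 'S_N, forall s, G s 0 (sg s) != 0.
  have := fullrowsub_unit fM; rewrite unitmxE unitfE => det0.
  have [sg sgP] : exists sg : 'S_N, \prod_s rowsub g M s (sg s) != 0.
    apply/existsP; apply: contraNT det0 => /existsPn sg0; apply/eqP/big1 => sg _.
    by have := sg0 sg; rewrite negbK => /eqP ->; rewrite mulr0.
  exists sg => s; move: sgP; rewrite prodf_seq_neq0 => /allP/(_ s (mem_index_enum s)).
  by rewrite /= !mxE.
(* Each extreme pair accounts for f central coordinates, and [sg] permutes these coordinates. *)
have -> : (\sum_(ij in extreme_pairs prec) f * #|F| ^ prec_alpha prec ij.1 ij.2 =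
    \sum_(s < N) #|F| ^ prec_alpha prec (val (enum_val (sg s)).1).1 (val (enum_val (sg s)).1).2)%N.
  rewrite -(reindex_inj (@perm_inj _ sg) (P := xpredT) (F := fun s => #|F| ^
    prec_alpha prec (val (enum_val s).1).1 (val (enum_val s).1).2)%N).
  rewrite -(big_enum_val (fun k : center_index => #|F| ^
    prec_alpha prec (val k.1).1 (val k.1).2)%N) /=.
  rewrite -(pair_bigA _ (fun x (l : 'I_f) => #|F| ^
    prec_alpha prec (val x).1 (val x).2)%N) /= big_sub.
  by apply: eq_bigr => x _; rewrite sum_nat_const card_ord.
(* The dimensions of all eigenspaces add up to d, and the selected characters are distinct. *)
rewrite -[X in (_ <= X)%N]sum_rank_center.
rewrite [X in (_ <= X)%N](bigID (mem (G @: setT))) /=.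
apply: leq_trans (leq_addr _ _); rewrite big_imset /= => [|s1 s2 _ _ /G_inj //].
rewrite [X in (_ <= X)%N](eq_bigl xpredT) => [|s]; last by rewrite inE.
apply: leq_sum => s _; apply: rank_pair_char; last by rewrite enum_valK.
by have := enum_valP (g s); rewrite inE.
Qed.

End LowerBound.

Theorem theorem2p10 (R : realType) (n : nat) (prec : strict_order n)
    (p f : nat) (F : finFieldType) (hp : prime p) (hf : (1 <= f)%N)
    (hF : #|F| = (p ^ f)%N) (hlen : (prec_length prec < p)%N) :
  is_m_faithful R[i] (lie_exp p (pattern_lie prec F))
    (\sum_(ij in extreme_pairs prec) f * (p ^ f) ^ prec_alpha prec ij.1 ij.2)%N.
Proof.
(* The exponential identifies exp(L) with 1 + L, where both bounds are proved. *)
have [h [h' hK h'K] hM] := pattern_exp_exists hp hF hlen.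
have [e [e0 eD e_inj]] := additive_char_exists R[i]%C hp.
have [c cB [cinv cK cinvK]] := Fp_coordinates_exist hp hF.
have h_circ x y : h (bch p x y) = circ (h x) (h y) by apply: val_inj; apply: hM.
rewrite -hF; split=> [|d rho [rho_unit rhoM rho_inj]].
  rewrite -card_monomial_index; exists (fun x => pattern_rep e c (h x)); split=> [x|x y|x y xy].
  - exact: (pattern_rep_unit e0 eD cB).
  - by rewrite -[(x * y)%g]/(bch p x y) h_circ (pattern_repM eD cB).
  - exact/(can_inj hK)/(pattern_rep_inj e0 eD e_inj (can_inj cK) hf xy).
apply: (lower_bound e0 eD e_inj cB cK cinvK (rho := fun g => rho (h' g))) => [x y||].
- by rewrite -rhoM; congr rho; rewrite -[RHS]hK -[(_ * _)%g]/(bch p _ _) h_circ !h'K.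
- by move=> g; apply: rho_unit.
- by move=> g1 g2 /rho_inj/(can_inj h'K).
Qed.
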